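(* Let $d,N\ge 1$ be integers, let $m_1,\dots,m_N>0$, and let $F=(F_j)_{1\le j\le N}:\mathbb{R}^N\times\mathbb{R}^N\times\mathbb{R}^{N\times d}\to\mathbb{R}^N$. Consider the system $$(\partial_t^2-\Delta+m_j^2)u_j=F_j(u,\partial_t u,Du),\qquad j=1,\dots,N, \qquad (\ast)$$ for an $\mathbb{R}^N$-valued unknown $u=(u_j)_{1\le j\le N}$ of $(t,x)$, $x\in\mathbb{R}^d$. Suppose that: (i) there is a constant $C_0>0$ such that for all $(\zeta,\eta,\Theta)\in\mathbb{R}^N\times\mathbb{R}^N\times\mathbb{R}^{N\times d}$, $$|F(\zeta,\eta,\Theta)|\le C_0\left(|\zeta|^2+|\eta|^2+|\Theta|_{Fr}^2\right)^{\frac12\left(1+\frac2d\right)};$$ (ii) classical solutions to the initial value problem for $(\ast)$ are unique: if $v$ and $w$ are two classical solutions of $(\ast)$ on a common time interval $I$ and $v(t_0,\cdot)=w(t_0,\cdot)$, $\partial_t v(t_0,\cdot)=\partial_t w(t_0,\cdot)$ for some $t_0\in I$, then $v\equiv w$ on $I\times\mathbb{R}^d$. Let $u$ be a forward-global classical solution of $(\ast)$, i.e. a classical solution on $[T,\infty)\times\mathbb{R}^d$ for some $T\in\mathbb{R}$. Assume that there exist constants $C>0$ and $T_1>1$ with $T_1\ge T$ such that $$\|u(t,\cdot)\|_{L^\infty(\mathbb{R}^d)}+\big\||Du(t,\cdot)|_{Fr}\big\|_{L^\infty(\mathbb{R}^d)}\le C\,t^{-\frac d2}(\log t)^{-\frac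 d2}\qquad\text{for all } t\ge T_1,$$ and that for every $\varepsilon>0$ there exists $T_2\ge T_1$ such that $$\|\partial_t u(t,\cdot)\|_{L^\infty(\mathbb{R}^d)}\le \varepsilon\, t^{-\frac d2}(\log t)^{-\frac d2}\qquad\text{for all } t\ge T_2.$$ Then $u$ is identically zero.
   Context: Here $\Delta=\sum_{k=1}^d\partial_k^2$ with $\partial_k=\partial_{x_k}$; $Du$ denotes the array of all spatial first derivatives $\partial_i u_j$, $1\le i\le d$, $1\le j\le N$, viewed as an element of $\mathbb{R}^{N\times d}$ (entry $(j,i)$ equal to $\partial_i u_j$). $|\cdot|$ is the Euclidean norm on $\mathbb{R}^N$, and $|\Theta|_{Fr}=\big(\sum_{i=1}^N\sum_{j=1}^d|\theta_{ij}|^2\big)^{1/2}$ is the Frobenius norm of $\Theta=(\theta_{ij})\in\mathbb{R}^{N\times d}$. A classical solution on a time interval $I\subset\mathbb{R}$ is a function $u$ of class $C^2$ on $I\times\mathbb{R}^d$ with values in $\mathbb{R}^N$ satisfying the system pointwise; no decay or integrability in $x$ is assumed. *)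

(* Defs.v *)
From HB Require Import structures.
From mathcomp Require Import all_boot all_order all_algebra.
From mathcomp Require Import all_classical all_reals all_analysis.

Set Implicit Arguments.
Unset Strict Implicit.
Unset Printing Implicit Defensive.

Import Order.TTheory GRing.Theory Num.Theory.
Import numFieldNormedType.Exports.

Local Open Scope classical_set_scope.
Local Open Scope ring_scope.

(* The norms of matrices built into the library are sup norms; they give the
   usual topology, but the estimates below are about the following ones. *)
Definition enorm (R : realType) (n : nat) (v : 'rV[R]_n) : R :=
  Num.sqrt (\sum_(i < n) v 0 i ^+ 2).

Definition frobenius (R : realType) (n d : nat) (A : 'M[R]_(n, d)) : R :=
  Num.sqrt (\sum_(i < n) \sum_(j < d) `|A i j| ^+ 2).

(* The library has no Lebesgue measure on R^d: it is obtained here from the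
   usual outer measure by Caratheodory's theorem. *)
Section lebesgue_rV.
Context (R : realType) (d : nat).

(* An open box, given by its lower and upper corners.  [None] is the empty set,
   so that a sequence of boxes also represents a finite family, even for
   d = 0. *)
Definition box (c : option ('rV[R]_d * 'rV[R]_d)) : set 'rV[R]_d :=
  if c is Some (a, b) then [set x | forall i, a 0 i < x 0 i < b 0 i] else set0.

Definition box_volume (c : option ('rV[R]_d * 'rV[R]_d)) : R :=
  if c is Some (a, b) then \prod_(i < d) Num.max 0 (b 0 i - a 0 i) else 0.

Definition lebesgue_outer (A : set 'rV[R]_d) : \bar R :=
  ereal_inf [set (\sum_(k <oo) (box_volume (c k))%:E)%E |
    c in [set c : nat -> option ('rV[R]_d * 'rV[R]_d) |
      A `<=` \bigcup_k box (c k)]].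

Local Open Scope ereal_scope.

Lemma box_volume_ge0 c : (0 <= box_volume c)%R.
Proof.
case: c => [[a b]|//=]; apply: prodr_ge0 => i _.
by rewrite le_max lexx.
Qed.

Lemma lebesgue_outer_ge0 A : 0 <= lebesgue_outer A.
Proof.
apply: le_ereal_inf_tmp => _ [c _ <-].
by apply: nneseries_ge0 => k _ _; rewrite lee_fin box_volume_ge0.
Qed.

Lemma lebesgue_outer0 : lebesgue_outer set0 = 0.
Proof.
apply/eqP; rewrite eq_le lebesgue_outer_ge0 andbT.
apply: ereal_inf_lbound; exists (fun=> None); first by [].
by rewrite eseries0.
Qed.

Lemma le_lebesgue_outer : {homo lebesgue_outer : A B / A `<=` B >-> A <= B}.
Proof.
move=> A B AB; apply/ereal_inf_le_tmp => _ [c Bc <-].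
by exists c => //; apply: subset_trans AB Bc.
Qed.

Lemma lebesgue_outer_sigma_subadditive : sigma_subadditive lebesgue_outer.
Proof.
move=> A; have [[i ioo]|] := pselect (exists i, lebesgue_outer (A i) = +oo).
  rewrite (eseries_pinfty _ _ ioo) ?leey// => n _.
  by rewrite -ltNye (lt_le_trans _ (lebesgue_outer_ge0 _)).
rewrite -forallNE => Aoo.
suff add2e (e : {posnum R}) : lebesgue_outer (\bigcup_n A n) <=
    \sum_(i <oo) lebesgue_outer (A i) + e%:num%:E.
  by apply/lee_addgt0Pr => _/posnumP[].
rewrite (le_trans _ (epsilon_trick _ _ _))//; last first.
  by move=> n; exact: lebesgue_outer_ge0.
pose P n (c : nat -> option ('rV[R]_d * 'rV[R]_d)) :=
  A n `<=` \bigcup_k box (c k) /\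
  \sum_(k <oo) (box_volume (c k))%:E <=
    lebesgue_outer (A n) + (e%:num / (2 ^ n.+1)%:R)%:E.
have [G PG] : {G & forall n, P n (G n)}.
  apply: (@choice _ _ P) => n; rewrite /P.
  have en1 : (0 < e%:num / (2 ^ n.+1)%:R :> R)%R by [].
  have fA : lebesgue_outer (A n) \is a fin_num.
    by rewrite ge0_fin_numE ?lebesgue_outer_ge0// ltey; apply/eqP.
  have [x [c Ac cx] xS] := lb_ereal_inf_adherent en1 fA.
  by exists c; split => //; rewrite cx; exact/ltW.
pose w (p : nat * nat) := (box_volume (G p.1 p.2))%:E.
have w_ge0 p : 0 <= w p by rewrite lee_fin box_volume_ge0.
apply: (@le_trans _ _ (\esum_(i in setT) w i)).
  apply: ereal_inf_lbound => /=.
  have /card_esym/ppcard_eqP[f] := card_nat2.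
  exists (fun k => G (f k).1 (f k).2).
    move=> t [i _] /(PG i).1 [j _ Gt]; exists (f^-1%FUN (i, j)) => //=.
    by rewrite invK ?inE.
  rewrite -(esum_pred_image w _ xpredT) ?[fun=> _]set_true//.
  by rewrite image_eq.
rewrite (_ : esum _ _ = \sum_(i <oo) \sum_(j <oo) w (i, j)); last first.
  pose J : nat -> set (nat * nat) := fun i => [set (i, j) | j in setT].
  rewrite (_ : setT = \bigcup_k J k); last first.
    by rewrite predeqE => -[a b]; split => // _; exists a => //; exists b.
  rewrite esum_bigcupT /=; last 2 first.
    - apply/trivIsetP => i j _ _ ij.
      rewrite predeqE => -[n m] /=; split => //= -[] [_] _ [<-{n} _].
      by move=> [m' _] [] /esym/eqP; rewrite (negbTE ij).
    - by move=> p; exact: w_ge0.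
  rewrite -(image_id [set: nat]) -fun_true esum_pred_image//; last first.
    by move=> n _; exact: esum_ge0.
  apply: eq_eseriesr => /= j _.
  rewrite -(esum_pred_image w (pair j) predT)//=; last first.
    by move=> ? ? _ _; exact: (@can_inj _ _ _ snd).
  by congr esum; rewrite predeqE => -[a b]; split; move=> [i _ <-]; exists i.
apply: lee_lim.
- by apply: is_cvg_nneseries => n *; apply: nneseries_ge0 => m *; exact: w_ge0.
- apply: is_cvg_nneseries => n *; apply: adde_ge0 => //.
  exact: lebesgue_outer_ge0.
- by near=> n; apply: lee_sum => i _; exact: (PG i).2.
Unshelve. all: by end_near. Qed.

HB.instance Definition _ := isOuterMeasure.Build R 'rV[R]_d lebesgue_outer
  lebesgue_outer0 lebesgue_outer_ge0 le_lebesgue_outer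
  lebesgue_outer_sigma_subadditive.

Definition lebesgue_rV :=
  [the {measure set (caratheodory_type lebesgue_outer) -> \bar R} of
    (lebesgue_outer : {outer_measure set 'rV[R]_d -> \bar R})
      : set (caratheodory_type lebesgue_outer) -> \bar R].

Definition Linfty_norm (f : 'rV[R]_d -> R) : \bar R :=
  'N[lebesgue_rV]_(+oo)[EFin \o f].

End lebesgue_rV.

(* Functions on I x R^d are total functions of t and x, of which only the
   values at times in [I] are used: the time derivative is the limit of the
   difference quotients taken within [I], hence one-sided at an end point of
   [I] which belongs to [I]. *)
Section derivatives.
Context (R : realType) (d : nat).
Implicit Types (I : set R) (f : R -> 'rV[R]_d -> R).

(* A non-degenerate interval, so that limits within [I] at points of [I] are
   meaningful. *)
Definition time_interval I :=
  is_interval I /\ exists a b, [/\ I a, I b & a < b].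

Definition time_quotient f t x : R -> R :=
  fun s => (f s x - f t x) / (s - t).

Definition time_derivable I f t x :=
  cvg (time_quotient f t x s @[s --> within I t^']).

Definition dt I f : R -> 'rV[R]_d -> R :=
  fun t x => lim (time_quotient f t x s @[s --> within I t^']).

Definition space_derivable (k : 'I_d) f t x :=
  derivable (f t) x 'e_k.

Definition dx (k : 'I_d) f : R -> 'rV[R]_d -> R :=
  fun t x => 'D_'e_k (f t) x.

Fixpoint Cn (n : nat) I f : Prop :=
  {within I `*` [set: 'rV[R]_d], continuous (fun p => f p.1 p.2)} /\
  if n is n'.+1 then
    [/\ forall t x, I t -> time_derivable I f t x,
        Cn n' I (dt I f),
        forall k t x, I t -> space_derivable k f t x &
        forall k, Cn n' I (dx k f)]
  else True.

End derivatives.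

Section system.
Context (R : realType) (d N : nat).
Implicit Types (I : set R) (u v w : R -> 'rV[R]_d -> 'rV[R]_N).

Definition component u (j : 'I_N) : R -> 'rV[R]_d -> R := fun t x => u t x 0 j.

Definition Dt I u : R -> 'rV[R]_d -> 'rV[R]_N :=
  fun t x => \row_j dt I (component u j) t x.

Definition Dx u : R -> 'rV[R]_d -> 'M[R]_(N, d) :=
  fun t x => \matrix_(j, i) dx i (component u j) t x.

Definition laplacian (f : R -> 'rV[R]_d -> R) : R -> 'rV[R]_d -> R :=
  fun t x => \sum_(k < d) dx k (dx k f) t x.

Definition classical_solution (m : 'I_N -> R)
    (F : 'rV[R]_N -> 'rV[R]_N -> 'M[R]_(N, d) -> 'rV[R]_N) I u :=
  (forall j, Cn 2 I (component u j)) /\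
  forall t x j, I t ->
    dt I (dt I (component u j)) t x - laplacian (component u j) t x
      + m j ^+ 2 * component u j t x
    = F (u t x) (Dt I u t x) (Dx u t x) 0 j.

Definition unique_classical_solutions (m : 'I_N -> R)
    (F : 'rV[R]_N -> 'rV[R]_N -> 'M[R]_(N, d) -> 'rV[R]_N) :=
  forall I v w, time_interval I ->
    classical_solution m F I v -> classical_solution m F I w ->
    (exists t0, [/\ I t0, forall x, v t0 x = w t0 x &
                    forall x, Dt I v t0 x = Dt I w t0 x]) ->
    forall t x, I t -> v t x = w t x.

End system.

(* Main.v *)
Require Import Defs.
From HB Require Import structures.
From mathcomp Require Import all_boot all_order all_algebra.
From mathcomp Require Import all_classical all_reals all_analysis.
From mathcomp Require Import ess_sup_inf.
From mathcomp Require Import ring lra.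

Set Implicit Arguments.
Unset Strict Implicit.
Unset Printing Implicit Defensive.

Import Order.TTheory GRing.Theory Num.Theory.
Import numFieldNormedType.Exports.

Local Open Scope classical_set_scope.
Local Open Scope ring_scope.

(* Write e for the energy density, rate t = (t ln t)^(-d/2), and U = (u, u_t, Du).
   Since |u_t| <= eps rate while |U| = O(rate), hypothesis (i) gives
   |F . u_t| <= e / (2 t ln t) once eps is small. With the cutoff
   phi = psi((r + t)^2 - |x|^2), whose domain of positivity grows at speed 1, the
   flux term has the good sign, so (ln t)^(1/2) \int phi e dx is nondecreasing.
   But the decay of U bounds this quantity by C (ln t)^(1/2 - d), which tends to 0;
   hence e vanishes for large t, and (ii) compares u with the zero solution.

   The integral is replaced by sums over a fine grid of step h: for a compactly
   supported C^1 function g, the mean value theorem and a telescoping sum give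
   h^d sum d_k g -> 0 as h -> 0, which is all of the divergence theorem that the
   argument needs. The same grids, with compactness of cubes, show that nonempty
   open sets have positive measure, so that L^oo bounds hold pointwise. *)

(** * Counting grid points *)

Section counting.
Variable R : realType.

(** With [m] the integer part of the positive part of [r - l] divided by [h], all indices counted
    lie among the [m + 1] consecutive integers that start at the smallest of them. *)
Lemma card_grid_itv_le (a h l r : R) n : 0 < h ->
  #|[pred j : 'I_n | l < a + h * j%:R < r]|%:R <= Num.max 0 (r - l) / h + 1.
Proof.
move=> h0; set P := [pred j : 'I_n | _].
have mx0 : 0 <= Num.max 0 (r - l) / h by rewrite divr_ge0 ?le_max ?lexx ?(ltW h0).
case: (pickP P) => [j1 Pj1|P0]; last first.
  by rewrite (eq_card P0) card0 addr_ge0.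
case: (@arg_minnP _ j1 P (@nat_of_ord n) Pj1) => j0 Pj0 j0min.
pose m := Num.truncn (Num.max 0 (r - l) / h).
apply: (@le_trans _ _ (m.+1)%:R); last first.
  by rewrite -natr1 lerD2r truncn_le.
rewrite ler_nat cardE -(size_map val) -(size_iota j0 m.+1).
apply: uniq_leq_size; first by rewrite map_inj_uniq ?enum_uniq//; exact: val_inj.
move=> _ /mapP[j + ->]; rewrite mem_enum => Pj.
rewrite mem_iota (j0min _ Pj)/= -ltn_subLR ?j0min//.
rewrite ltnS truncn_ge_nat//.
have /andP[lj jr] := Pj; have /andP[lj0 j0r] := Pj0.
rewrite (natrB _ (j0min _ Pj)) ler_pdivlMr//.
rewrite le_max; apply/orP; right; nra.
Qed.

(** The [m] indices that follow the integer part of [(l - a) / h] all give points of the interval,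
    [m] being the integer part of [(r - l) / h]. Rounding costs the [1], and the bound on [r] keeps
    these indices below [n]. *)
Lemma card_grid_itv_ge (a h l r : R) n : 0 < h -> a <= l -> l <= r ->
  r < a + h * n%:R ->
  (r - l) / h - 1 <= #|[pred j : 'I_n | l <= a + h * j%:R <= r]|%:R.
Proof.
move=> h0 al lr rn; set P := [pred j : 'I_n | _].
pose m := Num.truncn ((r - l) / h); pose j0 := (Num.truncn ((l - a) / h)).+1.
have rlh : 0 <= (r - l) / h by rewrite divr_ge0 ?subr_ge0 ?(ltW h0).
have lah : 0 <= (l - a) / h by rewrite divr_ge0 ?subr_ge0 ?(ltW h0).
apply: (@le_trans _ _ m%:R).
  by rewrite lerBlDr natr1 ltW// truncnS_gt.
rewrite ler_nat cardE -(size_map val) -(size_iota j0 m).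
apply: uniq_leq_size; first exact: iota_uniq.
move=> j; rewrite mem_iota => /andP[j0j jm].
have lj : l <= a + h * j%:R.
  have : (l - a) / h < j%:R.
    by apply: lt_le_trans (truncnS_gt _) _; rewrite ler_nat.
  by rewrite ltr_pdivrMr//; lra.
have jr : a + h * j%:R <= r.
  have h1 : m%:R <= (r - l) / h by rewrite truncn_le.
  have h2 : (Num.truncn ((l - a) / h))%:R <= (l - a) / h by rewrite truncn_le.
  have : j%:R <= (Num.truncn ((l - a) / h))%:R + m%:R :> R.
    by rewrite -natrD ler_nat -ltnS.
  rewrite !ler_pdivlMr// in h1 h2; nra.
have jn : (j < n)%N.
  by rewrite -(ltr_nat R) -(ltr_pM2l h0); lra.
by apply/mapP; exists (Ordinal jn) => //; rewrite mem_enum inE/= lj jr.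
Qed.

End counting.

Section grid.
Variables (R : realType) (d : nat).

(** The face at [a + h * n] is left out, as on a torus, so that a cyclic shift of one index permutes
    the grid. *)
Definition grid n (a : 'rV[R]_d) (h : R) (f : {ffun 'I_d -> 'I_n}) : 'rV[R]_d :=
  \row_i (a 0 i + h * (f i)%:R).

Lemma card_grid n (P : 'I_d -> pred 'I_n) :
  #|[pred f : {ffun 'I_d -> 'I_n} | [forall i, P i (f i)]]|
    = (\prod_(i < d) #|P i|)%N.
Proof.
rewrite (_ : #|_| = #|family P|).
  by rewrite card_family foldrE big_map big_enum.
by apply: eq_card => f; rewrite !inE.
Qed.

End grid.

(** * Lebesgue outer measure of open sets *)

Section outer.
Variables (R : realType) (d : nat).
Implicit Type c : option ('rV[R]_d * 'rV[R]_d).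

Lemma open_box c : open (box c).
Proof.
case: c => [[a b]|]; last exact: open0.
rewrite openE => x /= xab.
exists (fun _ j => `]a 0 j, b 0 j[%classic).
  move=> i j; rewrite (ord1 i); apply: open_nbhs_nbhs; split => //=.
  by rewrite in_itv/= xab.
by move=> y /= yab i; have := yab 0 i; rewrite in_itv.
Qed.

(* A box meets at most [fat_volume c h / h ^+ d] points of a grid of step [h]. *)
Definition fat_volume c (h : R) : R :=
  if c is Some (a, b) then \prod_(i < d) (Num.max 0 (b 0 i - a 0 i) + h) else 0.

Lemma fat_volume0 c : fat_volume c 0 = box_volume c.
Proof.
by case: c => [[a b]|//] /=; apply: eq_bigr => i _; rewrite addr0.
Qed.

Lemma cvg_fat_volume c : fat_volume c h @[h --> 0] --> box_volume c.
Proof.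
rewrite -fat_volume0.
case: c => [[a b]|/=]; last exact: cvg_cst.
rewrite /=; apply: cvg_big => //.
  exact: mul_continuous.
by move=> i _; apply: cvgD; [exact: cvg_cst|exact: cvg_id].
Qed.

Definition in_box c (x : 'rV[R]_d) : bool :=
  if c is Some (a, b) then [forall i, a 0 i < x 0 i < b 0 i] else false.

Lemma in_boxP c x : reflect (box c x) (in_box c x).
Proof.
case: c => [[a b]|/=]; last by apply: (iffP idP).
by apply: (iffP forallP) => // ?.
Qed.

Lemma card_grid_box n (a : 'rV[R]_d) h c : 0 < h ->
  #|[pred f : {ffun 'I_d -> 'I_n} | in_box c (grid a h f)]|%:R * h ^+ d
    <= fat_volume c h.
Proof.
move=> h0; case: c => [[l r]|] /=; last first.
  by rewrite (@eq_card _ _ pred0)// card0 mul0r.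
pose P i : pred 'I_n := [pred j : 'I_n | l 0 i < a 0 i + h * j%:R < r 0 i].
have -> : #|[pred f : {ffun 'I_d -> 'I_n} | [forall i, l 0 i < grid a h f 0 i < r 0 i]]|
    = #|[pred f : {ffun 'I_d -> 'I_n} | [forall i, P i (f i)]]|.
  by apply: eq_card => f; rewrite !inE; apply: eq_forallb => i; rewrite mxE.
rewrite (card_grid P) natr_prod -[X in h ^+ X]card_ord -prodr_const -big_split/=.
apply: ler_prod => i _; rewrite mulr_ge0 ?(ltW h0)//=.
have cP := card_grid_itv_le (a 0 i) (l 0 i) (r 0 i) n h0.
apply: le_trans (ler_wpM2r (ltW h0) cP) _.
by rewrite mulrDl mul1r divfK// gt_eqF.
Qed.

(** By compactness finitely many boxes of a cover of [A] already cover the closed cube. They contain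
    the [n ^ d] points of a grid of step [2 * r / n], so [(2 * r) ^+ d] is at most the sum of their
    values [fat_volume], which tends to the sum of their volumes as [n] grows. *)
Lemma lebesgue_outer_cube_ge (x0 : 'rV[R]_d) (r : R) (A : set 'rV[R]_d) :
  0 < r -> (forall x : 'rV[R]_d, (forall i, `|x 0 i - x0 0 i| <= r) -> A x) ->
  (((2 * r) ^+ d)%:E <= lebesgue_outer A)%E.
Proof.
move=> r0 QA; apply: le_ereal_inf_tmp => _ [c Ac <-].
pose Q := [set x : 'rV[R]_d | forall i, `[x0 0 i - r, x0 0 i + r]%classic (x 0 i)].
have Qabs x : Q x -> forall i, `|x 0 i - x0 0 i| <= r.
  by move=> Qx i; have := Qx i; rewrite /= in_itv/= ler_distl.
have : compact Q.
  by apply: (@rV_compact _ _ (fun i => `[x0 0 i - r, x0 0 i + r]%classic)) => i;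
    exact: segment_compact.
rewrite compact_cover => /(_ _ setT (fun k => box (c k))) [].
- by move=> k _; exact: open_box.
- by move=> x /Qabs/QA/Ac.
(* [M] exceeds every index of the subcover, so the first [M] boxes suffice and the sum of their
   volumes is a partial sum of the series. *)
move=> D _ QD; pose M := (\max_(k <- finmap.enum_fset D) k).+1.
have {}QD x : Q x -> exists2 k, (k < M)%N & box (c k) x.
  move=> /QD[k /= kD ckx]; exists k => //.
  by rewrite ltnS; exact: leq_bigmax_seq.
apply: le_trans (nneseries_lim_ge M _); last first.
  by move=> k _ _; rewrite lee_fin box_volume_ge0.
rewrite sumEFin lee_fin.
have key n : (0 < n)%N ->
    (2 * r) ^+ d <= \sum_(0 <= k < M) fat_volume (c k) (2 * r / n%:R).
  move=> n0; set h := 2 * r / n%:R; pose a : 'rV_d := \row_i (x0 0 i - r).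
  have n0' : (0 : R) < n%:R by rewrite ltr0n.
  have h0 : 0 < h by rewrite divr_gt0// mulr_gt0.
  have -> : (2 * r) ^+ d = #|{ffun 'I_d -> 'I_n}|%:R * h ^+ d.
    by rewrite card_ffun !card_ord natrX -exprMn; congr (_ ^+ _); rewrite [RHS]mulrC divfK// gt_eqF.
  apply: (@le_trans _ _ (\sum_(0 <= k < M)
      #|[pred f : {ffun 'I_d -> 'I_n} | in_box (c k) (grid a h f)]|%:R * h ^+ d)).
    (* Double counting: each grid point lies in at least one of the first [M] boxes. *)
    rewrite -mulr_suml ler_pM2r ?exprn_gt0// -natr_sum ler_nat.
    under eq_bigr do rewrite -sum1_card big_mkcond/=.
    rewrite exchange_big/= -sum1_card; apply: leq_sum => f _.
    have /QD[k kM /in_boxP kf] : Q (grid a h f).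
      move=> i; rewrite /= in_itv/= !mxE.
      have : h * (f i)%:R <= 2 * r.
        rewrite /h -mulrA ler_piMr ?mulr_ge0 ?(ltW r0)//.
        by rewrite mulrC ler_pdivrMr// mul1r ler_nat ltnW.
      have : 0 <= h * (f i)%:R by rewrite mulr_ge0 ?(ltW h0).
      by lra.
    rewrite big_mkord (bigD1 (Ordinal kM))//= inE kf.
    by rewrite leq_addr.
  by apply: ler_sum => k _; exact: card_grid_box.
have cvh : 2 * r / n.+1%:R @[n --> \oo] --> (0 : R).
  by rewrite -[0](mulr0 (2 * r)); apply: cvgMl_tmp; exact: cvg_harmonic.
have cvs : \sum_(0 <= k < M) fat_volume (c k) h @[h --> 0]
    --> \sum_(0 <= k < M) box_volume (c k).
  by apply: cvg_big => [|k _]; [exact: add_continuous|exact: cvg_fat_volume].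
apply: (cvgr_to_ge (cvg_comp _ _ cvh cvs)).
by near=> n; exact: key.
Unshelve. all: by end_near. Qed.

(** If [f x0 > M], continuity puts a whole cube around [x0] into the exceptional null set, whose
    outer measure would then be positive. *)
Lemma Linfty_norm_ge (f : 'rV[R]_d -> R) (M : R) :
  continuous f -> (Linfty_norm f <= M%:E)%E -> forall x, f x <= M.
Proof.
move=> cf fM x0; rewrite leNgt; apply/negP => Mf.
(* The norm at infinity is an essential supremum only when the total measure is positive; otherwise
   it is [0] by convention. *)
have : (0 < lebesgue_rV R d setT)%E.
  have := @lebesgue_outer_cube_ge 0 1 setT ltr01 (fun _ _ => I).
  by apply: lt_le_trans; rewrite lte_fin exprn_gt0// mulr_gt0.
move: fM; rewrite /Linfty_norm unlock => + mu0; rewrite mu0 => /ess_supP/=[B [mB B0 fB]].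
have /cf/nbhs_ballP[e /= e0 fe] : nbhs (f x0) `]M, +oo[%classic.
  by apply: open_nbhs_nbhs; split => //=; rewrite in_itv/= Mf.
have e20 : 0 < e / 2 by rewrite divr_gt0.
have : (((2 * (e / 2)) ^+ d)%:E <= lebesgue_outer B)%E.
  apply: (@lebesgue_outer_cube_ge x0) => // x xx0.
  apply: fB => /=; apply/negP; rewrite -ltNge lte_fin.
  have /fe : ball x0 e x.
    split=> // i j; rewrite (ord1 i) /ball/= distrC.
    by apply: le_lt_trans (xx0 j) _; lra.
  rewrite /= in_itv/= andbT => /lt_le_trans; apply; exact: ler_norm.
rewrite [lebesgue_outer B]B0 lee_fin leNgt exprn_gt0//; lra.
Qed.
End outer.

(** * Grid sums *)

Section lines.
Variables (R : realType) (V : normedModType R).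
Implicit Types (f df : V -> R) (x v : V).

Lemma is_derive_line f df v :
  (forall x, is_derive x v f (df x)) -> forall x (t : R),
  is_derive t 1 (fun s : R => f (s *: v + x)) (df (t *: v + x)).
Proof.
move=> fdf x t.
have E : (fun h : R => h^-1 *: (((fun s => f (s *: v + x)) \o shift t) (h *: 1)
      - f (t *: v + x)))
    = (fun h => h^-1 *: ((f \o shift (t *: v + x)) (h *: v) - f (t *: v + x))).
  by apply/funext => h /=; rewrite [h *: 1]mulr1 scalerDl addrA.
have [dfx <-] := fdf (t *: v + x).
by apply: DeriveDef; rewrite /derivable /derive E.
Qed.

(** At parameter [0] the difference quotients along the line are those of the directional
    derivative. Explicit functions can thus be differentiated by one-variable rules. *)
Lemma is_derive_along f x v (l : R) :
  is_derive (0 : R) 1 (fun s : R => f (s *: v + x)) l -> is_derive x v f l.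
Proof.
have E : (fun h : R => h^-1 *: (((fun s => f (s *: v + x)) \o shift 0) (h *: 1)
      - f (0 *: v + x)))
    = (fun h => h^-1 *: ((f \o shift x) (h *: v) - f x)).
  by apply/funext => h /=; rewrite [h *: 1]mulr1 scale0r add0r addr0.
move=> [dfx dl].
have dE : 'D_v f x = 'D_1 (fun s : R => f (s *: v + x)) 0 by rewrite /derive E.
by rewrite -dl -dE; apply: DeriveDef => //; rewrite /derivable -E.
Qed.

Lemma MVT_line f df v x h : (forall x, is_derive x v f (df x)) -> 0 < h ->
  exists2 s, 0 <= s <= h & f (h *: v + x) - f x = h * df (s *: v + x).
Proof.
move=> fdf h0; have fl := is_derive_line fdf x.
have [|s] := @MVT_segment R (fun s => f (s *: v + x)) (fun s => df (s *: v + x))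
  0 h (ltW h0) (fun s _ => fl s).
  apply: derivable_within_continuous => s _; exact: ex_derive.
by rewrite in_itv/= scale0r add0r subr0 mulrC => s0h E; exists s.
Qed.

End lines.

Section gridsum.
Variables (R : realType) (d : nat).
Implicit Types (a x : 'rV[R]_d) (g dg : 'rV[R]_d -> R).

(* The shift is cyclic in the index: the one step that wraps around joins two
   opposite faces of the box, where [g] vanishes. *)
Lemma sum_grid_shift n a h k g :
  (forall x, x 0 k = a 0 k -> g x = 0) ->
  (forall x, x 0 k = a 0 k + h * n%:R -> g x = 0) ->
  \sum_(f : {ffun 'I_d -> 'I_n}) g (h *: 'e_k + grid a h f)
    = \sum_(f : {ffun 'I_d -> 'I_n}) g (grid a h f).
Proof.
move=> ga gb.
pose sh (f : {ffun 'I_d -> 'I_n}) := [ffun i => if i == k then ordS (f i) else f i].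
pose us (f : {ffun 'I_d -> 'I_n}) := [ffun i => if i == k then ord_pred (f i) else f i].
have shK : cancel sh us.
  by move=> f; apply/ffunP => i; rewrite !ffunE; case: eqP => // _; rewrite ordSK.
have usK : cancel us sh.
  by move=> f; apply/ffunP => i; rewrite !ffunE; case: eqP => // _; rewrite ord_predK.
rewrite [RHS](reindex sh)/=; last by exists us => f _.
apply: eq_bigr => f _.
have [fn|nf] := ltnP (f k).+1 n.
  congr g; apply/rowP => i; rewrite !mxE ffunE eqxx/=.
  case: (eqVneq i k) => [->|ik]; last by rewrite mulr0 add0r.
  rewrite /= modn_small// mulr1 -natr1; ring.
have fk : (f k).+1 = n by apply/eqP; rewrite eqn_leq nf ltn_ord.
rewrite gb ?ga// !mxE ?ffunE ?eqxx/=.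
  by rewrite fk modnn mulr0 addr0.
have -> : (n%:R : R) = (f k)%:R + 1 by rewrite natr1 fk.
by ring.
Qed.

(** By the mean value theorem each increment divided by [h] is a value of [dg] on a grid edge, hence
    within [eta] of [dg] at the grid point; the increments themselves sum to zero by the cyclic
    shift. *)
Lemma grid_divergence n a h k g dg (eta : R) : 0 < h ->
  (forall x, is_derive x 'e_k g (dg x)) ->
  (forall x, x 0 k = a 0 k -> g x = 0) ->
  (forall x, x 0 k = a 0 k + h * n%:R -> g x = 0) ->
  (forall (f : {ffun 'I_d -> 'I_n}) s, 0 <= s <= h ->
    `|dg (s *: 'e_k + grid a h f) - dg (grid a h f)| <= eta) ->
  `|\sum_(f : {ffun 'I_d -> 'I_n}) dg (grid a h f)| <= (n ^ d)%:R * eta.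
Proof.
move=> h0 gdg ga gb dgeta.
have sum0 : \sum_(f : {ffun 'I_d -> 'I_n})
    h^-1 * (g (h *: 'e_k + grid a h f) - g (grid a h f)) = 0.
  by rewrite -mulr_sumr big_split/= sumrN sum_grid_shift// subrr mulr0.
rewrite -[X in `|X|]subr0 -{2}sum0 -sumrB; apply: le_trans (ler_norm_sum _ _ _) _.
have -> : (n ^ d)%:R * eta = \sum_(f : {ffun 'I_d -> 'I_n}) eta.
  by rewrite sumr_const card_ffun !card_ord mulr_natl.
apply: ler_sum => f _.
have [s s0h ->] := MVT_line (grid a h f) gdg h0.
by rewrite mulKf ?gt_eqF// distrC dgeta.
Qed.

(** In each coordinate an interval of length [2 * delta] holds at least
    [2 * delta / h - 1 >= delta / h] grid values, because [h <= delta]. *)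
Lemma grid_lower_bound n a h g (x0 : 'rV[R]_d) (delta c : R) :
  0 < h -> h <= delta -> 0 <= c -> (forall x, 0 <= g x) ->
  (forall x, (forall i, `|x 0 i - x0 0 i| <= delta) -> c <= g x) ->
  (forall i, a 0 i <= x0 0 i - delta) ->
  (forall i, x0 0 i + delta < a 0 i + h * n%:R) ->
  c * delta ^+ d <= h ^+ d * \sum_(f : {ffun 'I_d -> 'I_n}) g (grid a h f).
Proof.
move=> h0 hd c0 g0 cg al rb.
pose P i : pred 'I_n :=
  [pred j : 'I_n | x0 0 i - delta <= a 0 i + h * j%:R <= x0 0 i + delta].
have Pg (f : {ffun 'I_d -> 'I_n}) : [forall i, P i (f i)] -> c <= g (grid a h f).
  move=> /forallP Pf; apply: cg => i; rewrite mxE ler_distl.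
  exact: Pf.
have := card_grid P => /(congr1 (fun k => k%:R : R)); rewrite natr_prod => cP.
have lb : delta ^+ d <= h ^+ d * #|[pred f : {ffun 'I_d -> 'I_n} | [forall i, P i (f i)]]|%:R.
  rewrite cP -{1 2}(card_ord d) -!prodr_const -big_split/=.
  apply: ler_prod => i _; rewrite (le_trans (ltW h0) hd)/=.
  have le1 : x0 0 i - delta <= x0 0 i + delta by lra.
  have := card_grid_itv_ge h0 (al i) le1 (rb i).
  move/(ler_wpM2l (ltW h0)); apply: le_trans.
  rewrite mulrBr mulr1 mulrC divfK ?gt_eqF//; lra.
apply: le_trans (ler_wpM2l c0 lb) _.
rewrite mulrCA ler_pM2l ?exprn_gt0// mulr_natr -sumr_const.
rewrite big_mkcond/=; apply: ler_sum => f _.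
by rewrite inE; case: ifPn => // /Pg.
Qed.

End gridsum.

(** * Uniform continuity on compact slabs *)

Section uniform.
Variables (R : realType) (d : nat).

(** Uniformity in [t] matters because the time of use will come from a mean value theorem applied
    after the grid is fixed. It follows from compactness of the time segment times a cube, in its
    near-covering form; [y] may leave the cube. *)
Lemma uniform_continuity_slab (G : R -> 'rV[R]_d -> R) (t0 t1 L eta : R) :
  (forall t x, t0 <= t <= t1 -> {for (t, x), continuous (fun p => G p.1 p.2)}) ->
  0 < eta -> \forall delta \near 0^'+,
    forall t (x y : 'rV[R]_d), t0 <= t <= t1 -> (forall i, `|x 0 i| <= L) ->
      `|x - y| < delta -> `|G t x - G t y| <= eta.
Proof.
move=> cG eta0.
pose Q := [set x : 'rV[R]_d | forall i, `[- L, L]%classic (x 0 i)].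
have cQ : compact Q.
  by apply: (@rV_compact _ _ (fun=> `[- L, L]%classic)) => i; exact: segment_compact.
have cK : compact (`[t0, t1]%classic `*` Q).
  by apply: compact_setX => //; exact: segment_compact.
have cov : \forall delta \near (0 : R)^'+, `[t0, t1]%classic `*` Q `<=` (fun p =>
    forall y, `|p.2 - y| < delta -> `|G p.1 p.2 - G p.1 y| <= eta).
  move/compact_near_coveringP : cK; apply.
  move=> [t x] [/= tt Qx].
  have tt' : t0 <= t <= t1 by move: tt; rewrite in_itv.
  have e2 : 0 < eta / 2 by rewrite divr_gt0.
  have /cvgrPdist_lt/(_ _ e2)/nbhs_ballP[r /= r0 Gr] := cG t x tt'.
  have r2 : 0 < r / 2 by rewrite divr_gt0.
  near=> p delta; have dr : delta <= r / 2 by near: delta; exact: nbhs_right_le.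
  move=> y py.
  have Hp : ball (t, x) (r / 2) p by near: p; exact: nbhsx_ballx.
  have [Hp1 Hp2] := Hp.
  have b1 : ball (t, x) r p by apply: le_ball Hp; lra.
  have b2 : ball (t, x) r (p.1, y).
    split => /=; first by apply: le_ball Hp1; lra.
    rewrite (splitr r); apply: ball_triangle Hp2 _.
    by rewrite -ball_normE /ball_/=; apply: lt_le_trans py dr.
  have /= := Gr _ b1; have /= := Gr _ b2; rewrite !ltr_distlC => A B.
  rewrite ler_distl; move: A B; set u := G t x; set v := G p.1 y; set w := G p.1 p.2.
  lra.
near=> delta.
have H : `[t0, t1]%classic `*` Q `<=` (fun p =>
    forall y, `|p.2 - y| < delta -> `|G p.1 p.2 - G p.1 y| <= eta).
  by near: delta; exact: cov.
move=> t x y tt Lx xy.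
apply: (H (t, x)) => //; split => /=; first by rewrite in_itv.
by move=> i /=; rewrite in_itv/= -ler_norml.
Unshelve. all: by end_near. Qed.
End uniform.

(** * Monotonicity of a weighted energy through grid sums *)

Lemma is_derive_bigsum (R : realType) (V : normedModType R) (I : Type) (r : seq I)
    (F : I -> V -> R) (dF : I -> R) (x v : V) :
  (forall i, is_derive x v (F i) (dF i)) ->
  is_derive x v (fun y => \sum_(i <- r) F i y) (\sum_(i <- r) dF i).
Proof.
move=> FdF; elim: r => [|i r IHr].
  rewrite big_nil (_ : (fun _ => _) = cst 0); first exact: is_derive_cst.
  by apply/funext => y; rewrite big_nil.
rewrite big_cons (_ : (fun _ => _) = F i + (fun y => \sum_(i <- r) F i y)).
  exact: is_deriveD.
by apply/funext => y; rewrite big_cons.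
Qed.

Lemma normr_err_le1 (R : realType) d (k : 'I_d) : `|'e_k : 'rV[R]_d| <= 1.
Proof.
rewrite [leLHS]mx_normrE; apply/bigmax_leP; split => // i _.
by rewrite mxE ger0_norm// lern1 leq_b1.
Qed.

Section energy.
Variables (R : realType) (d : nat) (t0 t1 L : R).
Variables (W W' : R -> 'rV[R]_d -> R) (g dg : 'I_d -> R -> 'rV[R]_d -> R) (w w' : R -> R).
Hypotheses (t01 : t0 < t1).
Hypothesis w_der : forall t, t0 <= t <= t1 -> is_derive t 1 w (w' t).
Hypothesis W_der : forall t x, t0 <= t <= t1 -> is_derive t 1 (W^~ x) (W' t x).
Hypothesis ineq : forall t x, t0 <= t <= t1 ->
  w t * \sum_k dg k t x <= w' t * W t x + w t * W' t x.
Hypothesis g_der : forall t k x, t0 <= t <= t1 -> is_derive x 'e_k (g k t) (dg k t x).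
Hypothesis g_supp : forall t (k : 'I_d) (x : 'rV[R]_d), t0 <= t <= t1 ->
  L <= `|x 0 k| -> g k t x = 0.
Hypothesis dg_cont : forall k t x, t0 <= t <= t1 ->
  {for (t, x), continuous (fun p => dg k p.1 p.2)}.

(** Discrete form of the fact that [w] times the integral of [W] is nondecreasing: by [ineq] its
    derivative is at least [w] times the integral of a compactly supported divergence. On a fine
    grid this holds up to an arbitrary [eta]. The grid sum is then bounded below at [t0] by the
    points near [x0], and above at [t1] by counting all points. *)
Lemma grid_energy (B : R) (x0 : 'rV[R]_d) (c delta M : R) :
  (forall t, t0 <= t <= t1 -> 0 <= w t <= B) ->
  (forall t x, t0 <= t <= t1 -> 0 <= W t x) ->
  0 <= c -> 0 < delta -> 0 < L -> (forall i, `|x0 0 i| + delta < L) ->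
  (forall x : 'rV[R]_d, (forall i, `|x 0 i - x0 0 i| <= delta) -> c <= W t0 x) ->
  (forall x, W t1 x <= M) ->
  w t0 * (c * delta ^+ d) <= w t1 * ((2 * L) ^+ d * M).
Proof.
move=> wB W0 c0 delta0 L0 x0L cW WM.
have tt0 : t0 <= t0 <= t1 by rewrite lexx ltW.
have tt1 : t0 <= t1 <= t1 by rewrite lexx andbT ltW.
have B0 : 0 <= B by have /andP[] := wB _ tt0; exact: le_trans.
apply/ler_addgt0Pr => eta eta0.
have t10 : 0 < t1 - t0 by rewrite subr_gt0.
(* [D] collects what multiplies an oscillation of the [dg k]: the volume of the cube, the number of
   directions, the bound on [w] and the duration. Hence [D * eta' <= eta]; the [1 +] below covers
   [D = 0]. *)
pose D := (2 * L) ^+ d * d%:R * B * (t1 - t0).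
have D0 : 0 <= D by rewrite !mulr_ge0 ?exprn_ge0 ?mulr_ge0 ?(ltW L0) ?(ltW t10).
pose eta' := eta / (1 + D).
have eta'0 : 0 < eta' by rewrite divr_gt0// ltr_pwDl.
have near_u : \forall e \near (0 : R)^'+, forall k t (x y : 'rV[R]_d),
    t0 <= t <= t1 -> (forall i, `|x 0 i| <= L) ->
    `|x - y| < e -> `|dg k t x - dg k t y| <= eta'.
  apply: filter_forall => k.
  by apply: uniform_continuity_slab => // t x; exact: dg_cont.
have [n [n0 hd hu]] : exists n, [/\ (0 < n)%N, 2 * L / n%:R <= delta &
   forall k t (x y : 'rV[R]_d), t0 <= t <= t1 -> (forall i, `|x 0 i| <= L) ->
    `|x - y| <= 2 * L / n%:R -> `|dg k t x - dg k t y| <= eta'].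
  near (0 : R)^'+ => e.
  have e0 : 0 < e by [].
  have L20 : 0 < 2 * L by rewrite mulr_gt0.
  have ne : 2 * L / (Num.truncn (2 * L / e)).+1%:R < e.
    by rewrite ltr_pdivrMr// [ltRHS]mulrC -ltr_pdivrMr// truncnS_gt.
  exists (Num.truncn (2 * L / e)).+1; split => //.
    by apply: le_trans (ltW ne) _; near: e; exact: nbhs_right_le.
  have He : forall k t (x y : 'rV[R]_d),
    t0 <= t <= t1 -> (forall i, `|x 0 i| <= L) ->
    `|x - y| < e -> `|dg k t x - dg k t y| <= eta' by near: e; exact: near_u.
  by move=> k t x y tt xL xy; apply: He => //; exact: le_lt_trans xy ne.
pose h := 2 * L / n%:R.
have n0' : (0 : R) < n%:R by rewrite ltr0n.
have h0 : 0 < h by rewrite divr_gt0// mulr_gt0.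
have hn : h * n%:R = 2 * L by rewrite divfK// gt_eqF.
(* The grid fills the cube of half-side [L] about the origin; its faces orthogonal to ['e_k] lie
   where [g k] vanishes. *)
pose a : 'rV[R]_d := const_mx (- L).
pose S t := \sum_(f : {ffun 'I_d -> 'I_n}) W t (grid a h f).
pose S' t := \sum_(f : {ffun 'I_d -> 'I_n}) W' t (grid a h f).
have S_der t : t0 <= t <= t1 ->
    is_derive t 1 (w * (fun t => h ^+ d * S t)) (h ^+ d * (w' t * S t + w t * S' t)).
  move=> tt; have := w_der tt.
  have : is_derive t 1 S (S' t).
    by apply: is_derive_bigsum => f; exact: W_der.
  move=> dS dw; apply: is_derive_eq.
  rewrite /GRing.scale/=; ring.
(* The mean value theorem replaces integration in time, so the derivative has to be estimated only
   at one unknown time [s]. *)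
have [||s] := @MVT_segment R (w * (fun t => h ^+ d * S t))
    (fun t => h ^+ d * (w' t * S t + w t * S' t)) t0 t1 (ltW t01).
- move=> s; rewrite in_itv/= => /andP[s0 s1]; apply: S_der.
  by rewrite !ltW.
- apply: derivable_within_continuous => s; rewrite in_itv/= => /S_der ds.
  exact: ex_derive.
rewrite in_itv/= => ss E.
have gridL (f : {ffun 'I_d -> 'I_n}) i : `|(grid a h f : 'rV[R]_d) 0 i| <= L.
  have : h * (f i)%:R <= 2 * L.
    by rewrite -hn ler_pM2l// ler_nat ltnW.
  have : 0 <= h * (f i)%:R by rewrite mulr_ge0 ?(ltW h0).
  by rewrite ler_norml !mxE; lra.
have dgS k : `|\sum_(f : {ffun 'I_d -> 'I_n}) dg k s (grid a h f)| <= (n ^ d)%:R * eta'.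
  apply: (@grid_divergence _ _ n a h k (g k s)) => //.
  - by move=> x; exact: g_der.
  - by move=> x xk; apply: g_supp => //; rewrite xk mxE normrN ger0_norm ?(ltW L0).
  - move=> x xk; apply: g_supp => //; rewrite xk mxE hn ger0_norm; lra.
  - move=> f r /andP[r0 rh]; rewrite distrC; apply: hu => //.
    rewrite opprD addrCA subrr addr0 normrN normrZ ger0_norm//.
    by apply: le_trans rh; rewrite ler_piMr// normr_err_le1.
have wSS : - (w s * (d%:R * ((n ^ d)%:R * eta'))) <= w' s * S s + w s * S' s.
  rewrite [leRHS](_ : _ = \sum_(f : {ffun 'I_d -> 'I_n})
      (w' s * W s (grid a h f) + w s * W' s (grid a h f))); last first.
    by rewrite big_split/= !mulr_sumr.
  apply: (@le_trans _ _ (\sum_(f : {ffun 'I_d -> 'I_n})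
      w s * \sum_k dg k s (grid a h f))); last first.
    by apply: ler_sum => f _; exact: ineq.
  rewrite -mulr_sumr exchange_big/= -mulrN.
  have /andP[ws0 _] := wB _ ss.
  apply: ler_wpM2l => //.
  rewrite lerNl; apply: le_trans (ler_norm _) _; rewrite normrN.
  apply: le_trans (ler_norm_sum _ _ _) _.
  rewrite mulr_natl -[X in _ *+ X](card_ord d) -sumr_const.
  by apply: ler_sum => k _.
have hnd : h ^+ d * (n ^ d)%:R = (2 * L) ^+ d by rewrite natrX -exprMn hn.
have : - eta <= (h ^+ d * (w' s * S s + w s * S' s)) * (t1 - t0).
  have hd0 : 0 <= h ^+ d by rewrite exprn_ge0// ltW.
  apply: le_trans (ler_wpM2r (ltW t10) (ler_wpM2l hd0 wSS)).
  have -> : h ^+ d * - (w s * (d%:R * ((n ^ d)%:R * eta'))) * (t1 - t0)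
      = - (w s * ((2 * L) ^+ d * d%:R * (t1 - t0)) * eta') by rewrite -hnd; ring.
  rewrite lerN2; apply: (@le_trans _ _ (D * eta')).
    apply: ler_wpM2r; first exact: ltW.
    have /andP[_ wsB] := wB _ ss.
    have -> : D = B * ((2 * L) ^+ d * d%:R * (t1 - t0)) by rewrite /D; ring.
    apply: ler_wpM2r => //.
    by rewrite !mulr_ge0 ?exprn_ge0 ?mulr_ge0 ?(ltW L0) ?(ltW t10).
  by rewrite /eta' mulrA ler_pdivrMr ?ltr_pwDl//; lra.
rewrite -E => {}E.
have {}E : - eta <= w t1 * (h ^+ d * S t1) - w t0 * (h ^+ d * S t0) := E.
have lb : c * delta ^+ d <= h ^+ d * S t0.
  apply: (grid_lower_bound h0 hd c0 _ cW) => [x|i|i].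
  - exact: W0.
  - by rewrite mxE; have := x0L i; have := ler_norm (- x0 0 i); rewrite normrN; lra.
  - by rewrite mxE hn; have := x0L i; have := ler_norm (x0 0 i); lra.
have ub : h ^+ d * S t1 <= (2 * L) ^+ d * M.
  have hd0 : 0 <= h ^+ d by rewrite exprn_ge0// ltW.
  rewrite -hnd -mulrA; apply: ler_wpM2l => //.
  have -> : (n ^ d)%:R * M = \sum_(f : {ffun 'I_d -> 'I_n}) M.
    by rewrite sumr_const card_ffun !card_ord mulr_natl.
  by apply: ler_sum.
have /andP[w00 _] := wB _ tt0; have /andP[w10 _] := wB _ tt1.
have := ler_wpM2l w00 lb; have := ler_wpM2l w10 ub; lra.
Unshelve. all: by end_near. Qed.
End energy.

(** * Derivatives at interior times *)

Section interior.
Variables (R : realType) (d : nat) (T : R).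
Local Notation I := (`[T, +oo[%classic : set R).
Implicit Types (f : R -> 'rV[R]_d -> R).

Lemma within_slab_continuous_for f t x :
  {within I `*` [set: 'rV[R]_d], continuous (fun p => f p.1 p.2)} -> T < t ->
  {for (t, x), continuous (fun p => f p.1 p.2)}.
Proof.
move=> cf Tt.
pose A : set (R * 'rV[R]_d) := fst @^-1` `]T, +oo[%classic.
have oA : open A by apply: open_comp => [p _|]; [exact: cvg_fst|exact: interval_open].
have := @continuous_subspaceW _ _ A _ _ _ cf.
rewrite continuous_open_subspace// => H; apply: H.
  by move=> [s y]; rewrite /A/= !in_itv/= !andbT => /ltW.
by rewrite inE /A/= in_itv/= Tt.
Qed.

(** For [t > T] all small increments stay in [I], so the limit within [I] is the two-sided one. *)
Lemma is_derive_dt f t x : time_derivable I f t x -> T < t ->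
  is_derive t 1 (f^~ x) (dt I f t x).
Proof.
move=> fd Tt.
have cf : time_quotient f t x s @[s --> within I t^'] --> dt I f t x by [].
have cg : (fun h : R => h^-1 *: (((f^~ x) \o shift t) (h *: 1) - f t x)) @ 0^'
    --> dt I f t x.
  apply/cvgrPdist_lt => e e0.
  have /cvgrPdist_lt/(_ _ e0) := cf; rewrite near_withinE => /nbhs_ballP[r /= r0 H].
  have m0 : 0 < Num.min r (t - T) by rewrite lt_min r0 subr_gt0.
  near=> h.
  have hn0 : h != 0 by near: h; exact: nbhs_dnbhs_neq.
  have : `|h| < Num.min r (t - T) by near: h; exact: dnbhs0_lt.
  rewrite lt_min => /andP[hr ht].
  have := H (h + t); rewrite /time_quotient addrK /= [h *: 1]mulr1 [_ *: _]mulrC.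
  apply.
  - by rewrite /ball/= opprD addrCA subrr addr0 normrN.
  - by rewrite -subr_eq0 addrK.
  - rewrite in_itv/= andbT; have := ler_norm (- h); rewrite normrN; lra.
by apply: DeriveDef; [apply/cvg_ex; exists (dt I f t x)|exact: cvg_lim cg].
Unshelve. all: by end_near. Qed.

(** The theorem of Schwarz. The second difference [D] equals [h ^+ 2] times either mixed derivative
    at some point close to [(t, x)], by two mean value theorems taken in either order; continuity of
    both derivatives then makes their values at [(t, x)] differ by at most [e]. *)
Lemma mixed_derivatives_eq (f ft fx ftx fxt : R -> 'rV[R]_d -> R) (k : 'I_d) :
  (forall t x, T < t -> is_derive t 1 (f^~ x) (ft t x)) ->
  (forall t x, T < t -> is_derive x 'e_k (f t) (fx t x)) ->
  (forall t x, T < t -> is_derive x 'e_k (ft t) (ftx t x)) ->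
  (forall t x, T < t -> is_derive t 1 (fx^~ x) (fxt t x)) ->
  (forall t x, T < t -> {for (t, x), continuous (fun p => ftx p.1 p.2)}) ->
  (forall t x, T < t -> {for (t, x), continuous (fun p => fxt p.1 p.2)}) ->
  forall t x, T < t -> ftx t x = fxt t x.
Proof.
move=> f_t f_x f_tx f_xt ctx cxt t x Tt.
apply/eqP; rewrite -subr_eq0 -normr_eq0 eq_le normr_ge0 andbT.
apply/ler_addgt0Pr => e e0; rewrite add0r.
have e2 : 0 < e / 2 by rewrite divr_gt0.
have /cvgrPdist_lt/(_ _ e2)/nbhs_ballP[r1 /= r10 H1] := ctx t x Tt.
have /cvgrPdist_lt/(_ _ e2)/nbhs_ballP[r2 /= r20 H2] := cxt t x Tt.
pose h := Num.min r1 r2 / 2.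
have h0 : 0 < h by rewrite divr_gt0// lt_min r10.
have /andP[hr1 hr2] : (h < r1) && (h < r2).
  by rewrite -lt_min /h ltr_pdivrMr// ltr_pMr ?ltr1n// lt_min r10.
have inball r s q : h < r -> t <= s <= t + h -> 0 <= q <= h ->
    ball (t, x) r (s, q *: 'e_k + x).
  move=> hr ts qh; split => /=.
    by rewrite /ball/= ltr_distl; lra.
  rewrite -ball_normE /ball_/= opprD addrCA subrr addr0 normrN normrZ.
  have /andP[q0 q1] := qh.
  rewrite ger0_norm//; apply: le_lt_trans hr; apply: le_trans q1.
  by rewrite ler_piMr// normr_err_le1.
have tth s : s \in `[t, (t + h)] -> t <= s <= t + h by rewrite in_itv.
have Ts s : t <= s <= t + h -> T < s by move=> /andP[ts _]; exact: lt_le_trans ts.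
pose D := f (t + h) (h *: 'e_k + x) - f (t + h) x - f t (h *: 'e_k + x) + f t x.
have tleth : t <= t + h by lra.
have th_end : t <= t + h <= t + h by rewrite tleth lexx.
have [s1 [q1 [s1h q1h E1]]] : exists s q, [/\ t <= s <= t + h, 0 <= q <= h &
    D = h ^+ 2 * ftx s (q *: 'e_k + x)].
  have gd s : t <= s <= t + h ->
      is_derive s 1 (f^~ (h *: 'e_k + x) - f^~ x) (ft s (h *: 'e_k + x) - ft s x).
    by move=> /Ts Tss; apply: is_deriveB; exact: f_t.
  have [||s] := @MVT_segment R (f^~ (h *: 'e_k + x) - f^~ x)
     (fun s => ft s (h *: 'e_k + x) - ft s x) t (t + h) tleth.
  - by move=> s; rewrite in_itv/= => /andP[/ltW a /ltW b]; apply: gd; rewrite a.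
  - by apply: derivable_within_continuous => s /tth/gd ?; exact: ex_derive.
  move=> /tth sh E.
  have [q qh E'] := MVT_line x (fun y => f_tx s y (Ts s sh)) h0.
  exists s, q; split => //; rewrite E' in E.
  have {}E : f (t + h) (h *: 'e_k + x) - f (t + h) x -
    (f t (h *: 'e_k + x) - f t x) = h * ftx s (q *: 'e_k + x) * (t + h - t) := E.
  have -> : h ^+ 2 * ftx s (q *: 'e_k + x) = h * ftx s (q *: 'e_k + x) * (t + h - t).
    by ring.
  by rewrite -E /D; ring.
have [s2 [q2 [s2h q2h E2]]] : exists s q, [/\ t <= s <= t + h, 0 <= q <= h &
    D = h ^+ 2 * fxt s (q *: 'e_k + x)].
  have gd y : is_derive y 'e_k (f (t + h) - f t) (fx (t + h) y - fx t y).
    by apply: is_deriveB; apply: f_x => //; exact: Ts.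
  have [q qh E] := MVT_line x gd h0.
  have fd s : t <= s <= t + h -> is_derive s 1 (fx^~ (q *: 'e_k + x)) (fxt s (q *: 'e_k + x)).
    by move=> /Ts; exact: f_xt.
  have [||s] := @MVT_segment R (fx^~ (q *: 'e_k + x))
     (fun s => fxt s (q *: 'e_k + x)) t (t + h) tleth.
  - by move=> s; rewrite in_itv/= => /andP[/ltW a /ltW b]; apply: fd; rewrite a.
  - by apply: derivable_within_continuous => s /tth/fd ?; exact: ex_derive.
  move=> /tth sh E'.
  exists s, q; split => //; rewrite E' in E.
  have {}E : f (t + h) (h *: 'e_k + x) - f t (h *: 'e_k + x) -
    (f (t + h) x - f t x) = h * (fxt s (q *: 'e_k + x) * (t + h - t)) := E.
  have -> : h ^+ 2 * fxt s (q *: 'e_k + x) = h * (fxt s (q *: 'e_k + x) * (t + h - t)).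
    by ring.
  by rewrite -E /D; ring.
have E : ftx s1 (q1 *: 'e_k + x) = fxt s2 (q2 *: 'e_k + x).
  by apply: (@mulfI _ (h ^+ 2)); rewrite ?expf_neq0 ?gt_eqF// -E1 -E2.
have := H1 _ (inball _ _ _ hr1 s1h q1h); have := H2 _ (inball _ _ _ hr2 s2h q2h).
rewrite /= E !ltr_distlC ler_norml; lra.
Qed.


Lemma CnS n f : Cn n.+1 I f ->
  [/\ forall t x, I t -> time_derivable I f t x, Cn n I (dt I f),
      forall k t x, I t -> space_derivable k f t x & forall k, Cn n I (dx k f)].
Proof. by case. Qed.

Lemma Cn_continuous_for n f : Cn n I f -> forall t x, T < t ->
  {for (t, x), continuous (fun p => f p.1 p.2)}.
Proof.
by move=> fn t x; apply: within_slab_continuous_for; case: n fn => [|n] [].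
Qed.

Lemma Cn_dt n f : Cn n.+1 I f -> Cn n I (dt I f).
Proof. by move=> /CnS[_ h _ _]. Qed.

Lemma Cn_dx n f k : Cn n.+1 I f -> Cn n I (dx k f).
Proof. by move=> /CnS[_ _ _ h]; exact: h. Qed.

Lemma Cn_is_derive_t n f : Cn n.+1 I f -> forall t x, T < t ->
  is_derive t 1 (f^~ x) (dt I f t x).
Proof.
move=> /CnS[h _ _ _] t x Tt; apply: is_derive_dt => //; apply: h.
by rewrite /= in_itv/= ltW.
Qed.

Lemma Cn_is_derive_x n f : Cn n.+1 I f -> forall t x k, T < t ->
  is_derive x 'e_k (f t) (dx k f t x).
Proof.
move=> /CnS[_ _ h _] t x k Tt; apply: DeriveDef; last by [].
by apply: h; rewrite /= in_itv/= ltW.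
Qed.

Lemma C2_mixed f k t x : Cn 2 I f -> T < t -> dx k (dt I f) t x = dt I (dx k f) t x.
Proof.
move=> f2; have f_t := Cn_dt f2; have f_x := Cn_dx k f2.
apply: (@mixed_derivatives_eq f (dt I f) (dx k f) (dx k (dt I f))
  (dt I (dx k f)) k) => {}t {}x Tt.
- exact: Cn_is_derive_t f2 _ _ Tt.
- exact: Cn_is_derive_x f2 _ _ k Tt.
- exact: Cn_is_derive_x f_t _ _ k Tt.
- exact: Cn_is_derive_t f_x _ _ Tt.
- exact: Cn_continuous_for (Cn_dx k f_t) _ _ Tt.
- exact: Cn_continuous_for (Cn_dt f_x) _ _ Tt.
Qed.

End interior.

(** * The cutoff function *)

Section cutoff.
Variable R : realType.
Implicit Types s : R.

(** This is [s ^+ 2 / (1 + s ^+ 2)] for [s > 0] and [0] otherwise: a bounded cutoff that is of class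
    C^1 because the square of the positive part is. *)
Definition psi s : R := 1 - (1 + Num.max 0 s ^+ 2)^-1.
Definition dpsi s : R := (1 + Num.max 0 s ^+ 2) ^- 2 * (2 * Num.max 0 s).

Lemma is_derive_sqr_max0 s :
  is_derive s 1 (fun s : R => Num.max 0 s ^+ 2) (2 * Num.max 0 s).
Proof.
have [s0|s0|->] := ltgtP s 0.
- rewrite mulr0.
  apply: (@near_eq_is_derive _ _ _ (cst 0)).
  near=> y; rewrite /= max_l ?expr0n//.
  suff : y \in `]-oo, 0[ by rewrite in_itv/= => /ltW.
  by near: y; apply: open_nbhs_nbhs; split; [exact: interval_open|rewrite /= in_itv].
- apply: (@near_eq_is_derive _ _ _ (fun y : R => y ^+ 2)).
    near=> y; rewrite /= max_r//.
    suff : y \in `]0, +oo[ by rewrite in_itv/= andbT => /ltW.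
    by near: y; apply: open_nbhs_nbhs; split; [exact: interval_open|rewrite /= in_itv/= s0].
  apply: is_derive_eq.
  rewrite /GRing.scale/=. ring.
(* At the junction point the difference quotient is [0] or [h], so its modulus is at most that of
   [h]. *)
- rewrite mulr0.
  have cg : (fun h : R => h^-1 *: (((fun s : R => Num.max 0 s ^+ 2) \o shift 0) (h *: 1)
      - Num.max 0 0 ^+ 2)) @ 0^' --> (0 : R).
    apply/cvgrPdist_lt => e e0; near=> h.
    have hn0 : h != 0 by near: h; exact: nbhs_dnbhs_neq.
    rewrite /= maxxx expr0n/= subr0 addr0 [h *: 1]mulr1 sub0r normrN normrZ normfV.
    have he : `|h| < e by near: h; exact: dnbhs0_lt.
    rewrite mulrC ltr_pdivrMr ?normr_gt0//.
    have [h0|h0] := leP h 0; first by rewrite expr0n/= normr0 mulr_gt0// normr_gt0.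
    by rewrite normrX expr2 ltr_pM2r ?normr_gt0.
  by apply: DeriveDef; [apply/cvg_ex; exists 0|exact: cvg_lim cg].
Unshelve. all: by end_near. Qed.

Lemma one_plus_sqr_gt0 (a : R) : 0 < 1 + a ^+ 2.
Proof. by rewrite ltr_pwDl// sqr_ge0. Qed.

Lemma is_derive_psi s : is_derive s 1 psi (dpsi s).
Proof.
have h0 : (cst 1 + (fun s : R => Num.max 0 s ^+ 2)) s != 0.
  by rewrite gt_eqF// one_plus_sqr_gt0.
have dq := is_derive_sqr_max0 s.
have dv := is_deriveV h0 (is_deriveD (is_derive_cst (1 : R) s 1) dq).
have d1 := is_deriveB (is_derive_cst (1 : R) s 1) dv.
apply: (@is_derive_eq _ _ _ _ _ _ _ _ d1).
by rewrite /dpsi /= sub0r add0r scaleNr opprK.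
Qed.

Lemma continuous_psi : continuous psi.
Proof.
move=> s; apply: differentiable_continuous; apply/derivable1_diffP.
by have [] := is_derive_psi s.
Qed.

Lemma continuous_dpsi : continuous dpsi.
Proof.
have cm : continuous (fun s : R => Num.max 0 s).
  by move=> s; apply: (@continuous_max _ _ (cst 0) id s); [exact: cvg_cst|exact: cvg_id].
move=> s; apply: cvgM; last by apply: cvgMl_tmp; exact: cm.
apply: cvgV; first by rewrite expf_neq0// gt_eqF// one_plus_sqr_gt0.
apply: (@continuous_comp _ _ _ (fun s : R => 1 + Num.max 0 s ^+ 2) (fun s => s ^+ 2) s);
  last exact: exprn_continuous.
apply: cvgD; first exact: cvg_cst.
apply: (@continuous_comp _ _ _ (fun s : R => Num.max 0 s) (fun s => s ^+ 2) s);
  [exact: cm|exact: exprn_continuous].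
Qed.

Lemma psi_ge0 s : 0 <= psi s.
Proof. by rewrite subr_ge0 invf_le1 ?one_plus_sqr_gt0// lerDl sqr_ge0. Qed.

Lemma psi_le1 s : psi s <= 1.
Proof. by rewrite gerBl invr_ge0 ltW// one_plus_sqr_gt0. Qed.

Lemma psi_gt0 s : 0 < s -> 0 < psi s.
Proof.
move=> s0; rewrite subr_gt0 invf_lt1 ?one_plus_sqr_gt0// ltrDl.
by rewrite max_r ?(ltW s0)// exprn_gt0.
Qed.

Lemma psi_eq0 s : s <= 0 -> psi s = 0.
Proof. by move=> s0; rewrite /psi max_l// expr0n/= addr0 invr1 subrr. Qed.

Lemma dpsi_eq0 s : s <= 0 -> dpsi s = 0.
Proof. by move=> s0; rewrite /dpsi max_l// !mulr0. Qed.

Lemma dpsi_ge0 s : 0 <= dpsi s.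
Proof. by rewrite mulr_ge0 ?mulr_ge0 ?le_max ?lexx// invr_ge0 sqr_ge0. Qed.

End cutoff.

(** * The expanding light cone *)

Section cone.
Variables (R : realType) (d : nat) (r : R).
Implicit Types (t : R) (x : 'rV[R]_d).

(** For [r + t >= 0] this is positive exactly in the open ball of radius [r + t]. *)
Definition cone t x : R := (r + t) ^+ 2 - \sum_i x 0 i ^+ 2.

Lemma is_derive_cone_t t x : is_derive t 1 (cone^~ x) (2 * (r + t)).
Proof.
rewrite [cone^~ x](_ : _ = (cst r + id) ^+ 2 - cst (\sum_i x 0 i ^+ 2))//.
apply: is_derive_eq.
rewrite /GRing.scale/= (_ : (cst r + id) t = r + t)//; ring.
Qed.

Lemma is_derive_cone_x t x k : is_derive x 'e_k (cone t) (- (2 * x 0 k)).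
Proof.
apply: is_derive_along.
have -> : (fun s : R => cone t (s *: 'e_k + x))
    = cst (cone t x) - (cst (2 * x 0 k) * id + id ^+ 2).
  apply/funext => s; rewrite /cone /=.
  have -> : \sum_i (s *: 'e_k + x) 0 i ^+ 2
      = \sum_i (x 0 i ^+ 2 + (i == k)%:R * (2 * x 0 k * s + s ^+ 2)).
    apply: eq_bigr => i _; rewrite !mxE eqxx/=.
    by case: eqP => [->|_]; rewrite /=; ring.
  rewrite big_split/= [X in _ - (_ + X)](bigD1 k)//= eqxx mul1r.
  rewrite [X in _ - (_ + (_ + X))]big1 ?addr0; last first.
    by move=> i /negPf ->; rewrite mul0r.
  rewrite (_ : (cst _ - _) s = (r + t) ^+ 2 - \sum_i x 0 i ^+ 2
    - (2 * x 0 k * s + s ^+ 2))//.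
  by ring.
apply: is_derive_eq.
rewrite /GRing.scale/=; ring.
Qed.

Lemma continuous_cone : continuous (fun p : R * 'rV[R]_d => cone p.1 p.2).
Proof.
move=> p; apply: cvgB.
  apply: (@continuous_comp _ _ _ (fun p : R * 'rV[R]_d => r + p.1) (fun s => s ^+ 2)).
    by apply: cvgD; [exact: cvg_cst|exact: cvg_fst].
  exact: exprn_continuous.
apply: cvg_big => [|i _]; first exact: add_continuous.
apply: (@continuous_comp _ _ _ (fun p : R * 'rV[R]_d => p.2 0 i) (fun s => s ^+ 2)).
  apply: (@continuous_comp _ _ _ snd (fun x : 'rV[R]_d => x 0 i)).
    exact: cvg_snd.
  exact: coord_continuous.
exact: exprn_continuous.
Qed.

(** A single large coordinate already puts [x] outside the ball; this is the support condition that
    a grid on a cube asks for. *)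
Lemma cone_le0 t x k : 0 <= r + t -> r + t <= `|x 0 k| -> cone t x <= 0.
Proof.
move=> rt rtx; rewrite subr_le0 (bigD1 k)//= ler_wpDr//.
  by apply: sumr_ge0 => i _; exact: sqr_ge0.
by rewrite -[leRHS](real_normK (num_real _)) ler_pXn2r ?nnegrE.
Qed.

End cone.

(* Completing the square: M^2 times the summand of index j is
   sum_k (M b_jk + x_k a_j)^2 + (M^2 - |x|^2) a_j^2. *)
Lemma light_cone_ineq (R : realType) (N d : nat) (M : R) (x : 'I_d -> R)
    (a : 'I_N -> R) (b : 'I_N -> 'I_d -> R) :
  0 < M -> \sum_k x k ^+ 2 <= M ^+ 2 ->
  0 <= M * (2^-1 * \sum_j (a j ^+ 2 + \sum_k b j k ^+ 2))
       + \sum_k x k * \sum_j a j * b j k.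
Proof.
move=> M0 xM.
have -> : \sum_k x k * \sum_j a j * b j k = \sum_j \sum_k x k * (a j * b j k).
  by rewrite exchange_big/=; apply: eq_bigr => k _; rewrite mulr_sumr.
rewrite mulrA mulr_sumr -big_split/=; apply: sumr_ge0 => j _.
have M20 : 0 < 2 * M by rewrite mulr_gt0.
rewrite -(pmulr_rge0 _ M20).
have -> : 2 * M * (M / 2 * (a j ^+ 2 + \sum_k b j k ^+ 2) + \sum_k x k * (a j * b j k))
  = \sum_k (M * b j k + x k * a j) ^+ 2 + (M ^+ 2 - \sum_k x k ^+ 2) * a j ^+ 2.
  transitivity (M ^+ 2 * a j ^+ 2 + (M ^+ 2 * \sum_k b j k ^+ 2
      + 2 * M * \sum_k x k * (a j * b j k))); first by field.
  rewrite mulrBl [RHS]addrCA; congr (_ + _).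
  rewrite mulr_suml -sumrB !mulr_sumr -big_split/=.
  by apply: eq_bigr => k _; ring.
apply: addr_ge0; first by apply: sumr_ge0 => k _; exact: sqr_ge0.
by apply: mulr_ge0; rewrite ?subr_ge0 ?sqr_ge0.
Qed.

(** * Local energy *)

Section local_energy.
Variables (R : realType) (d N : nat) (T : R) (m : 'I_N -> R).
Implicit Types (r t : R) (x : 'rV[R]_d).
(* [v], [b], [a], [vx], [bx] stand for u_t, Du, u_tt, Du_t and the pure second
   space derivatives of [u]. *)
Variables (u v a : 'I_N -> R -> 'rV[R]_d -> R).
Variables (b vx bx : 'I_N -> 'I_d -> R -> 'rV[R]_d -> R).
Variable F : 'I_N -> R -> 'rV[R]_d -> R.
Hypothesis u_t : forall j t x, T < t -> is_derive t 1 (u j ^~ x) (v j t x).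
Hypothesis v_t : forall j t x, T < t -> is_derive t 1 (v j ^~ x) (a j t x).
Hypothesis b_t : forall j k t x, T < t -> is_derive t 1 (b j k ^~ x) (vx j k t x).
Hypothesis v_x : forall j k t x, T < t -> is_derive x 'e_k (v j t) (vx j k t x).
Hypothesis b_x : forall j k t x, T < t -> is_derive x 'e_k (b j k t) (bx j k t x).
Hypothesis u_c : forall j t x, T < t -> {for (t, x), continuous (fun p => u j p.1 p.2)}.
Hypothesis v_c : forall j t x, T < t -> {for (t, x), continuous (fun p => v j p.1 p.2)}.
Hypothesis b_c : forall j k t x, T < t -> {for (t, x), continuous (fun p => b j k p.1 p.2)}.
Hypothesis vx_c : forall j k t x, T < t -> {for (t, x), continuous (fun p => vx j k p.1 p.2)}.
Hypothesis bx_c : forall j k t x, T < t -> {for (t, x), continuous (fun p => bx j k p.1 p.2)}.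
Hypothesis eqn : forall j t x, T < t ->
  a j t x = \sum_k bx j k t x - m j ^+ 2 * u j t x + F j t x.

Definition energy t x : R :=
  2^-1 * \sum_j (v j t x ^+ 2 + \sum_k b j k t x ^+ 2 + m j ^+ 2 * u j t x ^+ 2).

Definition energy_t t x : R :=
  \sum_j (v j t x * a j t x + \sum_k b j k t x * vx j k t x
    + m j ^+ 2 * (u j t x * v j t x)).

Definition flux (k : 'I_d) t x : R := \sum_j v j t x * b j k t x.

Definition flux_x (k : 'I_d) t x : R :=
  \sum_j (v j t x * bx j k t x + b j k t x * vx j k t x).

Lemma energy_ge0 t x : 0 <= energy t x.
Proof.
apply: mulr_ge0 => //; apply: sumr_ge0 => j _.
have sb : 0 <= \sum_k b j k t x ^+ 2 by apply: sumr_ge0 => k _; exact: sqr_ge0.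
by have := sqr_ge0 (v j t x); have := mulr_ge0 (sqr_ge0 (m j)) (sqr_ge0 (u j t x)); lra.
Qed.

Lemma is_derive_energy t x : T < t -> is_derive t 1 (energy^~ x) (energy_t t x).
Proof.
move=> Tt.
have sq (g : R -> R) dg : is_derive t 1 g dg ->
    is_derive t 1 (fun t => g t ^+ 2) (2 * (g t * dg)).
  move=> ?; rewrite (_ : (fun _ => _) = g ^+ 2)//; apply: is_derive_eq.
  by rewrite /GRing.scale/=; ring.
have cm (c : R) (g : R -> R) dg : is_derive t 1 g dg ->
    is_derive t 1 (fun t => c * g t) (c * dg).
  move=> ?; rewrite (_ : (fun _ => _) = cst c * g)//; apply: is_derive_eq.
  by rewrite /GRing.scale/=; ring.
have -> : energy_t t x = 2^-1 * \sum_j (2 * (v j t x * a j t x)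
    + \sum_k 2 * (b j k t x * vx j k t x) + m j ^+ 2 * (2 * (u j t x * v j t x))).
  rewrite mulr_sumr; apply: eq_bigr => j _; by rewrite -mulr_sumr; field.
apply: (cm _ (fun t => \sum_j (v j t x ^+ 2 + \sum_k b j k t x ^+ 2
  + m j ^+ 2 * u j t x ^+ 2))).
apply: is_derive_bigsum => j.
apply: is_deriveD; last by apply: cm; apply: sq; exact: u_t.
apply: is_deriveD; first by apply: sq; exact: v_t.
by apply: is_derive_bigsum => k; apply: sq; exact: b_t.
Qed.

(** Once the equation replaces [a j], the mass terms cancel, and the products of [v] with [bx] and
    of [b] with [vx] form the divergence of the flux. *)
Lemma energy_balance t x : T < t ->
  energy_t t x = \sum_k flux_x k t x + \sum_j v j t x * F j t x.
Proof.
move=> Tt; rewrite exchange_big/= -big_split/=; apply: eq_bigr => j _.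
by rewrite eqn// big_split/= -mulr_sumr; ring.
Qed.

Lemma is_derive_flux k t x : T < t -> is_derive x 'e_k (flux k t) (flux_x k t x).
Proof.
move=> Tt; apply: is_derive_bigsum => j.
have := v_x j k x Tt; have := b_x j k x Tt => ? ?.
rewrite (_ : (fun _ => _) = v j t * b j k t)//; exact: is_deriveM.
Qed.

Definition weight r t x : R := psi (cone r t x).

Lemma is_derive_weight_t r t x :
  is_derive t 1 ((weight r)^~ x) (dpsi (cone r t x) * (2 * (r + t))).
Proof.
rewrite (_ : (weight r)^~ x = @psi R \o (cone r)^~ x)//.
by apply: is_derive1_comp; [exact: is_derive_psi|exact: is_derive_cone_t].
Qed.

Lemma is_derive_weight_x r t x k :
  is_derive x 'e_k (weight r t) (dpsi (cone r t x) * - (2 * x 0 k)).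
Proof.
apply: is_derive_along.
rewrite (_ : (fun _ => _) = @psi R \o (fun s : R => cone r t (s *: 'e_k + x)))//.
have dc : is_derive (0 : R) 1 (fun s : R => cone r t (s *: 'e_k + x)) (- (2 * x 0 k)).
  have := is_derive_line (fun x => is_derive_cone_x r t x k) x 0.
  by rewrite scale0r add0r.
apply: is_derive1_comp.
by have := is_derive_psi (cone r t (0 *: 'e_k + x)); rewrite {2}scale0r add0r.
Qed.

Lemma continuous_weight r :
  continuous (fun p : R * 'rV[R]_d => weight r p.1 p.2).
Proof.
move=> p; apply: (@continuous_comp _ _ _ (fun p => cone r p.1 p.2) (@psi R)).
  exact: continuous_cone.
exact: continuous_psi.
Qed.

Definition current r k t x : R := weight r t x * flux k t x.

Definition current_x r k t x : R :=
  weight r t x * flux_x k t x + flux k t x * (dpsi (cone r t x) * - (2 * x 0 k)).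

Lemma is_derive_current r k t x : T < t ->
  is_derive x 'e_k (current r k t) (current_x r k t x).
Proof.
move=> Tt; have := is_derive_flux k x Tt; have := is_derive_weight_x r t x k => ? ?.
rewrite (_ : current r k t = weight r t * flux k t)//; exact: is_deriveM.
Qed.

Lemma continuous_current_x r k t x : T < t ->
  {for (t, x), continuous (fun p => current_x r k p.1 p.2)}.
Proof.
move=> Tt.
have coord : (fun p : R * 'rV[R]_d => p.2 0 k) p @[p --> (t, x)] --> x 0 k.
  apply: (@continuous_comp _ _ _ snd (fun x : 'rV[R]_d => x 0 k) (t, x)).
    exact: cvg_snd.
  exact: coord_continuous.
apply: cvgD; apply: cvgM.
- exact: continuous_weight.
- apply: cvg_big => [|j _]; first exact: add_continuous.
  by apply: cvgD; apply: cvgM;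
    [exact: v_c|exact: bx_c|exact: b_c|exact: vx_c].
- apply: cvg_big => [|j _]; first exact: add_continuous.
  by apply: cvgM; [exact: v_c|exact: b_c].
- apply: cvgM; last by apply: cvgN; apply: cvgMl_tmp.
  apply: (@continuous_comp _ _ _ (fun p => cone r p.1 p.2) (@dpsi R) (t, x)).
    exact: continuous_cone.
  exact: continuous_dpsi.
Qed.

Lemma continuous_energy t x : T < t ->
  {for (t, x), continuous (fun p => energy p.1 p.2)}.
Proof.
move=> Tt.
have sq (g : R * 'rV[R]_d -> R) : {for (t, x), continuous g} ->
    g p ^+ 2 @[p --> (t, x)] --> g (t, x) ^+ 2.
  by move=> cg; apply: (@continuous_comp _ _ _ g (fun s => s ^+ 2) (t, x)) => //;
    exact: exprn_continuous.
apply: cvgMl_tmp; apply: cvg_big => [|j _]; first exact: add_continuous.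
apply: cvgD; last by apply: cvgMl_tmp; apply: sq; exact: u_c.
apply: cvgD; first by apply: sq; exact: v_c.
by apply: cvg_big => [|k _]; [exact: add_continuous|apply: sq; exact: b_c].
Qed.

(** The term [c * energy] absorbs the power of the nonlinearity. What remains comes from
    differentiating the cutoff: [2 * dpsi] times [(r + t) * energy + x . flux], which is nonnegative
    inside the cone by [light_cone_ineq], while [dpsi] vanishes outside. *)
Lemma weighted_energy_ineq r t x c : T < t -> 0 < r + t ->
  `|\sum_j v j t x * F j t x| <= c * energy t x ->
  \sum_k current_x r k t x <= c * (weight r t x * energy t x)
    + (weight r t x * energy_t t x + energy t x * (dpsi (cone r t x) * (2 * (r + t)))).
Proof.
move=> Tt rt Fc; rewrite energy_balance// big_split/= -mulr_sumr.
have w0 : 0 <= weight r t x by exact: psi_ge0.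
have c0 : 0 <= weight r t x * (c * energy t x + \sum_j v j t x * F j t x).
  by apply: mulr_ge0 => //; move: Fc; rewrite ler_norml => /andP[]; lra.
have -> : \sum_k flux k t x * (dpsi (cone r t x) * - (2 * x 0 k))
    = - (2 * dpsi (cone r t x) * \sum_k x 0 k * flux k t x).
  by rewrite mulr_sumr -sumrN; apply: eq_bigr => k _; ring.
have h : 0 <= dpsi (cone r t x) *
    ((r + t) * energy t x + \sum_k x 0 k * flux k t x).
  have [p0|p0] := leP (cone r t x) 0; first by rewrite dpsi_eq0// mul0r.
  apply: mulr_ge0; first exact: dpsi_ge0.
  have xM : \sum_k x 0 k ^+ 2 <= (r + t) ^+ 2 by move: p0; rewrite subr_gt0 => /ltW.
  (* The inequality is applied without the mass terms, which only increase the energy. *)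
  apply: le_trans (light_cone_ineq (v ^~ t ^~ x) (fun j k => b j k t x) rt xM) _.
  rewrite lerD2r ler_pM2l// ler_pM2l ?invr_gt0//; apply: ler_sum => j _.
  by rewrite lerDl mulr_ge0 ?sqr_ge0.
lra.
Qed.

(** The factor [w], with logarithmic derivative [c], compensates the possible loss [c * energy], so
    [w] times the integral of the cut-off energy is nondecreasing. The constant [K] is chosen before
    [t1], which can therefore be sent to infinity. *)
Lemma local_energy (r t0 : R) (x0 : 'rV[R]_d) (c w : R -> R) :
  T < t0 -> 0 < r + t0 -> 0 < cone r t0 x0 -> 0 < energy t0 x0 ->
  (forall t, t0 <= t -> is_derive t 1 w (c t * w t)) ->
  (forall t, t0 <= t -> 0 <= w t) ->
  (forall s t, t0 <= s -> s <= t -> w s <= w t) ->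
  (forall t x, t0 <= t -> `|\sum_j v j t x * F j t x| <= c t * energy t x) ->
  exists2 K, 0 < K & forall t1 M, t0 < t1 -> (forall x, energy t1 x <= M) ->
    K * w t0 <= w t1 * ((2 * (r + t1)) ^+ d * M).
Proof.
move=> Tt0 rt0 p0 e0 dw w0 wmono Fc.
pose W t x := weight r t x * energy t x.
have W00 : 0 < W t0 x0 by rewrite mulr_gt0// psi_gt0.
have W20 : 0 < W t0 x0 / 2 by rewrite divr_gt0.
have cW : {for x0, continuous (W t0)}.
  have cW' : {for (t0, x0), continuous (fun p => W p.1 p.2)}.
    by apply: cvgM; [exact: continuous_weight|exact: continuous_energy].
  apply: (@continuous_comp _ _ _ (fun x => (t0, x)) (fun p => W p.1 p.2) x0) => //.
  exact: (@cvg_pair _ _ _ (nbhs x0) (nbhs t0) (nbhs x0) _ _ _ (cst t0) id (cvg_cst t0) cvg_id).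
have /cvgrPdist_lt/(_ _ W20)/nbhs_ballP[e /= e_gt0 He] := cW.
have near_d : \forall delta \near (0 : R)^'+, forall i : 'I_d, `|x0 0 i| + delta < r + t0.
  apply: filter_forall => i.
  have xi : `|x0 0 i| < r + t0.
    rewrite ltNge; apply/negP => /(cone_le0 (ltW rt0)); rewrite leNgt p0//.
  near=> delta; rewrite -ltrBrDl; near: delta; apply: nbhs_right_lt.
  by rewrite subr_gt0.
near (0 : R)^'+ => delta.
have delta0 : 0 < delta by [].
have de : delta < e by near: delta; exact: nbhs_right_lt.
have dx0 : forall i : 'I_d, `|x0 0 i| + delta < r + t0 by near: delta.
(* By continuity [W t0] stays above half its value at [x0] on the cube of half-side [delta]. *)
exists (W t0 x0 / 2 * delta ^+ d); first by rewrite mulr_gt0// exprn_gt0.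
move=> t1 M t01 eM; rewrite [leLHS]mulrC.
have Tt t : t0 <= t <= t1 -> T < t by move=> /andP[t0t _]; exact: lt_le_trans t0t.
have rtp t : t0 <= t <= t1 -> 0 < r + t by move=> /andP[t0t _]; lra.
(* The half-side [r + t1] contains the support of the cutoff up to time [t1], and [w t1] bounds [w]
   by monotonicity. *)
apply: (@grid_energy _ _ t0 t1 (r + t1) W
  (fun t x => weight r t x * energy_t t x
     + energy t x * (dpsi (cone r t x) * (2 * (r + t))))
  (current r) (current_x r) w (fun t => c t * w t) _ _ _ _ _ _ _ (w t1) x0) => //.
- by move=> t /andP[t0t _]; exact: dw.
- move=> t x tt; have := is_derive_weight_t r t x; have := is_derive_energy x (Tt _ tt).
  by move=> ? ?; rewrite (_ : W^~ x = (weight r)^~ x * energy^~ x)//; exact: is_deriveM.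
- move=> t x tt; have /andP[t0t _] := tt.
  have := weighted_energy_ineq (Tt _ tt) (rtp _ tt) (Fc t x t0t).
  by move=> /(ler_wpM2l (w0 t t0t)); rewrite /W; lra.
- by move=> t k x tt; apply: is_derive_current; exact: Tt.
- move=> t k x tt xk; rewrite /current /weight psi_eq0 ?mul0r//.
  apply: (@cone_le0 _ _ _ _ _ k); first by apply: ltW; exact: rtp.
  by apply: le_trans xk; have /andP[_] := tt; lra.
- by move=> k t x tt; apply: continuous_current_x; exact: Tt.
- by move=> t /andP[t0t tt1]; rewrite w0// wmono.
- by move=> t x tt; rewrite mulr_ge0 ?energy_ge0// psi_ge0.
- exact: ltW.
- lra.
- by move=> i; have := dx0 i; lra.
- move=> x xx0; have /He : ball x0 e x.
    split=> // i j; rewrite (ord1 i) /ball/= distrC.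
    by apply: le_lt_trans (xx0 j) _.
  by rewrite /= ltr_distl; lra.
- move=> x; apply: le_trans (eM x); rewrite /W ler_piMl ?energy_ge0//.
  exact: psi_le1.
Unshelve. all: by end_near. Qed.
End local_energy.

(** * The nonlinearity *)

(** To be applied with [A] the decay rate, [B] the norm of [U], [a] that of u_t, and [s = 2 / d],
    for which [A ^ s] is [1 / (t ln t)]. *)
Lemma small_nonlinearity (R : realType) (s kappa C : R) :
  0 < s -> 0 < kappa -> 0 < C ->
  exists2 eps, 0 < eps <= 1 & forall A B a : R, 0 < A -> 0 <= a -> a <= B ->
    B <= C * A -> a <= eps * A ->
    (B ^+ 2) `^ (2^-1 * (1 + s)) * a <= kappa * A `^ s * B ^+ 2.
Proof.
move=> s0 k0 C0.
pose delta := kappa `^ s^-1.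
have delta0 : 0 < delta by rewrite powR_gt0.
have deltas : delta `^ s = kappa by rewrite -powRrM mulVf ?gt_eqF// powRr1// ltW.
have Cs0 : 0 < C `^ s by rewrite powR_gt0.
(* The second entry makes [eps / delta * C ^ s <= kappa]; the bound by [1] keeps the total decay
   constant independent of [eps]. *)
pose eps := Num.min 1 (kappa * delta / C `^ s).
have eps0 : 0 < eps by rewrite lt_min ltr01 divr_gt0// mulr_gt0.
have epsl : eps <= kappa * delta / C `^ s by rewrite ge_min lexx orbT.
exists eps => [|A B a A0 a0 aB BCA aeA]; first by rewrite eps0 ge_min lexx.
have B0 : 0 <= B := le_trans a0 aB.
have As0 : 0 < A `^ s by rewrite powR_gt0.
have -> : (B ^+ 2) `^ (2^-1 * (1 + s)) = B * B `^ s.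
  rewrite powRrM powR12_sqrt ?sqr_ge0// sqrtr_sqr ger0_norm// powRD ?powRr1//.
  by rewrite (_ : (1 + s == 0) = false)//; apply/negbTE; rewrite gt_eqF// addr_gt0.
(* If [B <= delta A], the factor [B^s] is small; otherwise [a <= (eps / delta) B]. *)
have [BdA|dAB] := leP B (delta * A).
  have BsA : B `^ s <= kappa * A `^ s.
    rewrite -deltas -powRM ?(ltW delta0) ?(ltW A0)//.
    by apply: ge0_ler_powR; rewrite ?nnegrE ?mulr_ge0 ?(ltW s0) ?(ltW delta0) ?(ltW A0).
  rewrite mulrAC [leRHS]mulrC; apply: ler_pM; rewrite ?mulr_ge0 ?powR_ge0//.
  by rewrite expr2 ler_wpM2l.
have aB' : a * C `^ s <= kappa * B.
  apply: (@le_trans _ _ (kappa * delta * A)).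
    apply: le_trans (ler_wpM2r (ltW Cs0) aeA) _.
    by rewrite mulrAC ler_wpM2r ?(ltW A0)// -ler_pdivlMr.
  by rewrite -mulrA ler_wpM2l// ltW.
have BsA : B `^ s <= C `^ s * A `^ s.
  rewrite -powRM ?(ltW C0) ?(ltW A0)//.
  by apply: ge0_ler_powR; rewrite ?nnegrE ?mulr_ge0 ?(ltW s0) ?(ltW C0) ?(ltW A0).
apply: (@le_trans _ _ (B * (C `^ s * A `^ s) * a)).
  by rewrite ler_wpM2r// ler_wpM2l.
have -> : B * (C `^ s * A `^ s) * a = B * A `^ s * (a * C `^ s) by ring.
have -> : kappa * A `^ s * B ^+ 2 = B * A `^ s * (kappa * B) by ring.
by rewrite ler_wpM2l// mulr_ge0// ltW.
Qed.

(** * Euclidean and Frobenius norms *)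

Section norms.
Variable R : realType.

Lemma enorm_ge0 n (v : 'rV[R]_n) : 0 <= enorm v.
Proof. exact: sqrtr_ge0. Qed.

Lemma enorm_sqr n (v : 'rV[R]_n) : enorm v ^+ 2 = \sum_j v 0 j ^+ 2.
Proof. by rewrite sqr_sqrtr// sumr_ge0// => j _; exact: sqr_ge0. Qed.

Lemma normr_le_enorm n (v : 'rV[R]_n) j : `|v 0 j| <= enorm v.
Proof.
rewrite -(@ler_pXn2r _ 2) ?nnegrE ?enorm_ge0// enorm_sqr real_normK ?num_real//.
rewrite (bigD1 j)//= lerDl sumr_ge0// => i _; exact: sqr_ge0.
Qed.

Lemma frobenius_sqr n d (A : 'M[R]_(n, d)) :
  frobenius A ^+ 2 = \sum_i \sum_j A i j ^+ 2.
Proof.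
rewrite sqr_sqrtr; last first.
  by apply: sumr_ge0 => i _; apply: sumr_ge0 => j _; rewrite sqr_ge0.
by apply: eq_bigr => i _; apply: eq_bigr => j _; rewrite real_normK ?num_real.
Qed.

Lemma continuous_enorm (T : topologicalType) n (f : T -> 'rV[R]_n) :
  (forall j, continuous (fun x => f x 0 j)) -> continuous (fun x => enorm (f x)).
Proof.
move=> cf x.
apply: (@continuous_comp _ _ _ (fun x => \sum_j f x 0 j ^+ 2) Num.sqrt x);
  last exact: sqrt_continuous.
apply: cvg_big => [|j _]; first exact: add_continuous.
by apply: (@continuous_comp _ _ _ (fun x => f x 0 j) (fun s => s ^+ 2) x);
  [exact: cf|exact: exprn_continuous].
Qed.

Lemma continuous_frobenius (T : topologicalType) n d (f : T -> 'M[R]_(n, d)) :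
  (forall i j, continuous (fun x => f x i j)) -> continuous (fun x => frobenius (f x)).
Proof.
move=> cf x.
apply: (@continuous_comp _ _ _ (fun x => \sum_i \sum_j `|f x i j| ^+ 2) Num.sqrt x);
  last exact: sqrt_continuous.
apply: cvg_big => [|i _]; first exact: add_continuous.
apply: cvg_big => [|j _]; first exact: add_continuous.
apply: (@continuous_comp _ _ _ (fun x => `|f x i j|) (fun s => s ^+ 2) x);
  last exact: exprn_continuous.
by apply: cvg_norm; exact: cf.
Qed.
End norms.

(** * The zero solution *)

Section zero_solution.
Variables (R : realType) (d : nat) (T : R).
Local Notation I := (`[T, +oo[%classic : set R).
Implicit Types (f : R -> 'rV[R]_d -> R).

Lemma time_quotient_zero f : (forall t x, I t -> f t x = 0) -> forall t x, I t ->
  time_quotient f t x s @[s --> within I t^'] --> (0 : R).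
Proof.
move=> f0 t x It; apply/cvgrPdist_lt => e e0; rewrite !near_withinE; near=> s => _ Is.
by rewrite /time_quotient !f0// subrr mul0r subrr normr0.
Unshelve. all: by end_near. Qed.

(** Uniqueness of the limit is taken along right neighbourhoods: they meet [I] at every point,
    including the end point [T]. *)
Lemma dt_zero f : (forall t x, I t -> f t x = 0) -> forall t x, I t -> dt I f t x = 0.
Proof.
move=> f0 t x It; have q0 := time_quotient_zero f0 x It.
have qd : time_quotient f t x s @[s --> within I t^'] --> dt I f t x.
  by apply/cvg_ex; exists 0.
have right_within : t^'+ `=>` within I t^'.
  move=> P; rewrite /within /= => HP.
  have : \forall s \near t^', I s -> P s by [].
  rewrite /dnbhs/at_right !near_withinE => {}HP.
  move: HP; apply: filterS => s Ps ts; apply: Ps; first by rewrite gt_eqF.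
  by move: It; rewrite /= !in_itv/= !andbT => /le_trans; apply; exact: ltW.
have q0' : time_quotient f t x s @[s --> t^'+] --> (0 : R).
  by apply: cvg_trans q0; exact: cvg_fmap2.
have qd' : time_quotient f t x s @[s --> t^'+] --> dt I f t x.
  by apply: cvg_trans qd; exact: cvg_fmap2.
exact: (cvg_unique _ qd' q0').
Qed.

Lemma dx_zero f k : (forall t x, I t -> f t x = 0) ->
  forall t x, I t -> dx k f t x = 0.
Proof.
move=> f0 t x It; rewrite /dx (_ : f t = cst 0); first exact: derive_cst.
by apply/funext => y; exact: f0.
Qed.

(** The hypothesis is restricted to times in [I] so that the induction passes to [dt I f], whose
    vanishing is known only there. *)
Lemma Cn_zero n f : (forall t x, I t -> f t x = 0) -> Cn n I f.
Proof.
have cf (g : R -> 'rV[R]_d -> R) : (forall t x, I t -> g t x = 0) ->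
    {within I `*` [set: 'rV[R]_d], continuous (fun p => g p.1 p.2)}.
  move=> g0; apply: (@subspace_eq_continuous _ _ _ (cst 0)).
    by move=> [t x]; rewrite inE => -[/= It _]; exact: esym (g0 t x It).
  exact: cst_continuous.
elim: n f => [|n IHn] f f0; first by split => //; exact: cf.
split; first exact: cf.
split.
- by move=> t x It; apply/cvg_ex; exists 0; exact: time_quotient_zero.
- by apply: IHn => t x It; exact: dt_zero.
- move=> k t x It; rewrite /space_derivable (_ : f t = cst 0).
    exact: derivable_cst.
  by apply/funext => y; exact: f0.
- by move=> k; apply: IHn => t x It; exact: dx_zero.
Qed.

Lemma zero_classical_solution N (m : 'I_N -> R)
    (F : 'rV[R]_N -> 'rV[R]_N -> 'M[R]_(N, d) -> 'rV[R]_N) : F 0 0 0 = 0 ->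
  classical_solution m F I (fun _ _ => 0).
Proof.
move=> F0; have c0 j t (x : 'rV[R]_d) : I t -> component (fun _ _ => 0 : 'rV[R]_N) j t x = 0.
  by rewrite /component mxE.
split=> [j|t x j It]; first by apply: Cn_zero => t x; exact: c0.
have -> : Dt I (fun _ _ => 0 : 'rV[R]_N) t x = 0.
  by apply/rowP => i; rewrite !mxE; apply: dt_zero It => s y; exact: c0.
have -> : Dx (fun _ _ => 0 : 'rV[R]_N) t x = 0.
  by apply/matrixP => i k; rewrite !mxE; apply: dx_zero It => s y; exact: c0.
rewrite F0 !mxE c0// mulr0 addr0 dt_zero//; last first.
  by move=> s y Is; apply: dt_zero => // s' y'; exact: c0.
rewrite /laplacian big1 ?subrr// => k _.
by apply: dx_zero => // s y Is; apply: dx_zero => // s' y'; exact: c0.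
Qed.
End zero_solution.

(** * Decay rates *)

Section rates.
Variables (R : realType) (d : nat).
Hypothesis d_gt0 : (0 < d)%N.

Definition rate (t : R) : R := t `^ (- (d%:R / 2)) * ln t `^ (- (d%:R / 2)).

Lemma rate_gt0 t : 1 < t -> 0 < rate t.
Proof. by move=> t1; rewrite mulr_gt0// powR_gt0 ?ln_gt0//; lra. Qed.

Lemma rate_powR t : 1 < t -> rate t `^ (2 / d%:R) = (t * ln t)^-1.
Proof.
move=> t1; have t0 : 0 < t by lra.
have dn0 : d%:R != 0 :> R by rewrite pnatr_eq0 -lt0n.
rewrite powRM ?powR_ge0// -!powRrM.
have -> : - (d%:R / 2) * (2 / d%:R) = -1 :> R by field.
by rewrite !powR_inv1 ?invfM// ltW// ln_gt0.
Qed.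

Lemma rate_sqr t : 1 < t -> rate t ^+ 2 = (t * ln t) ^- d.
Proof.
move=> t1; have t0 : 0 < t by lra.
rewrite exprMn -[X in X * _]powR_mulrn ?powR_ge0// -[X in _ * X]powR_mulrn ?powR_ge0//.
rewrite -!powRrM.
have -> : - (d%:R / 2) * 2%:R = - d%:R :> R by field.
by rewrite !powR_invn ?exprMn ?invfM// ltW// ln_gt0.
Qed.

(** The integrating factor for the rate [1 / (2 t ln t)], which is the bound obtained for the power
    of the nonlinearity relative to the energy. *)
Definition log_weight (t : R) : R := ln t `^ 2^-1.

Lemma is_derive_log_weight (t : R) : 1 < t ->
  is_derive t 1 log_weight (2^-1 * (t * ln t)^-1 * log_weight t).
Proof.
move=> t1; have t0 : 0 < t by lra.
have l0 : 0 < ln t by rewrite ln_gt0.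
have dp := is_derive1_powR 2^-1 l0; have dl := is_derive1_ln t0.
rewrite (_ : log_weight = (@powR R)^~ 2^-1 \o @ln R)//.
have dc := @is_derive1_comp R (@powR R ^~ 2^-1) (@ln R) t _ _ dp dl.
apply: is_derive_eq.
rewrite powRB ?powRr1 ?(ltW l0)//; last by apply/implyP => _; rewrite gt_eqF.
by rewrite /log_weight /= invfM; ring.
Qed.

Lemma le_log_weight s t : 1 < s -> s <= t -> log_weight s <= log_weight t.
Proof.
move=> s1 st; apply: ge0_ler_powR; rewrite ?nnegrE ?invr_ge0//.
- by rewrite ltW// ln_gt0.
- by rewrite ltW// ln_gt0// (lt_le_trans s1).
- by rewrite ler_ln// posrE; lra.
Qed.

(** The volume is at most [(4 * t) ^+ d] for large [t], against [(t * ln t) ^- d] from the squared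
    rate; what is left is a multiple of [(ln t) ^ (1/2 - d)], which tends to zero since [d >= 1]. *)
Lemma rate_limit (r t0 K M : R) : 0 <= r -> 0 <= M ->
  (forall t, t0 < t -> 1 < t ->
    K <= log_weight t * ((2 * (r + t)) ^+ d * (M * rate t ^+ 2))) ->
  K <= 0.
Proof.
move=> r0 M0 KM; rewrite leNgt; apply/negP => K0.
(* The time is [t = expR y]. The bound to contradict is [q * K / sqrt y], so [y > q ^+ 2] suffices;
   the other summands of [y] ensure [t0 < t], [r <= t] and [1 <= y]. *)
pose q := M * 4 ^+ d / K.
have q0 : 0 <= q by rewrite divr_ge0 ?mulr_ge0 ?exprn_ge0// ltW.
pose y := 1 + `|t0| + r + q ^+ 2.
have yq : q ^+ 2 < y by rewrite /y; have := normr_ge0 t0; lra.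
have y1 : 1 <= y by rewrite /y; have := normr_ge0 t0; have := sqr_ge0 q; lra.
have y0 : 0 < y by lra.
pose t := expR y.
have ty : 1 + y <= t by exact: expR_ge1Dx.
have tt0 : t0 < t by have := ler_norm t0; have := sqr_ge0 q; move: ty; rewrite /y; lra.
have tr : r <= t by have := normr_ge0 t0; have := sqr_ge0 q; move: ty; rewrite /y; lra.
have t1 : 1 < t by lra.
have t_gt0 : 0 < t by lra.
have := KM t tt0 t1; rewrite rate_sqr// /log_weight /t expRK -/t powR12_sqrt ?(ltW y0)//.
apply/negP; rewrite -ltNge.
set z := Num.sqrt y.
have z0 : 0 < z by rewrite sqrtr_gt0.
have zy : z ^+ 2 = y by rewrite sqr_sqrtr// ltW.
have qz : q < z by rewrite -(@ltr_pXn2r _ 2) ?nnegrE ?(ltW z0)// zy.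
(* Here [y ^- d <= y^-1], from [1 <= y] and [0 < d]. *)
have bound : (2 * (r + t)) ^+ d * (t * y) ^- d <= 4 ^+ d * y^-1.
  rewrite (exprMn _ t y) invfM mulrA.
  apply: ler_pM; rewrite ?mulr_ge0 ?exprn_ge0 ?invr_ge0 ?exprn_ge0//; try lra.
    rewrite ler_pdivrMr ?exprn_gt0// -exprMn lerXn2r ?nnegrE; lra.
  rewrite lef_pV2 ?posrE ?exprn_gt0//.
  by rewrite -[leLHS]expr1 ler_weXn2l.
have -> : (2 * (r + t)) ^+ d * (M * (t * y) ^- d)
  = M * ((2 * (r + t)) ^+ d * (t * y) ^- d) by ring.
apply: (@le_lt_trans _ _ (z * (M * (4 ^+ d * y^-1)))).
  by apply: ler_wpM2l; [exact: ltW|exact: ler_wpM2l].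
have -> : z * (M * (4 ^+ d * y^-1)) = q * K / z.
  rewrite -zy /q; field; rewrite !gt_eqF//.
by rewrite ltr_pdivrMr// mulrC ltr_pM2l.
Qed.
End rates.

(** * From pointwise decay to vanishing *)

Lemma Linfty_add_le (R : realType) (d : nat) (f g : 'rV[R]_d -> R) (M : R) :
  continuous f -> continuous g -> (Linfty_norm f + Linfty_norm g <= M%:E)%E ->
  (forall x, f x <= M) /\ (forall x, g x <= M).
Proof.
move=> cf cg fgM; split; apply: Linfty_norm_ge => //; apply: le_trans fgM.
  by apply: leeDl; exact: Lnorm_ge0.
by apply: leeDr; exact: Lnorm_ge0.
Qed.

Theorem theorem1p1 (R : realType) (d N : nat) (d_gt0 : (0 < d)%N)
    (N_gt0 : (0 < N)%N) (m : 'I_N -> R) (m_gt0 : forall j, 0 < m j)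
    (F : 'rV[R]_N -> 'rV[R]_N -> 'M[R]_(N, d) -> 'rV[R]_N)
    (F_bound : exists C0 : R, 0 < C0 /\
      forall (zeta eta : 'rV[R]_N) (Theta : 'M[R]_(N, d)),
        enorm (F zeta eta Theta) <=
        C0 * (enorm zeta ^+ 2 + enorm eta ^+ 2 + frobenius Theta ^+ 2)
               `^ (2^-1 * (1 + 2 / d%:R)))
    (F_unique : unique_classical_solutions m F)
    (T : R) (u : R -> 'rV[R]_d -> 'rV[R]_N)
    (u_sol : classical_solution m F `[T, +oo[ u)
    (C T1 : R) (C_gt0 : 0 < C) (T1_gt1 : 1 < T1) (T_le_T1 : T <= T1)
    (u_decay : forall t : R, T1 <= t ->
      (Linfty_norm (fun x => enorm (u t x))
         + Linfty_norm (fun x => frobenius (Dx u t x))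
       <= (C * t `^ (- (d%:R / 2)) * ln t `^ (- (d%:R / 2)))%:E)%E)
    (ut_decay : forall eps : R, 0 < eps ->
      exists T2 : R, T1 <= T2 /\
        forall t : R, T2 <= t ->
          (Linfty_norm (fun x => enorm (Dt `[T, +oo[ u t x))
           <= (eps * t `^ (- (d%:R / 2)) * ln t `^ (- (d%:R / 2)))%:E)%E) :
  forall (t : R) (x : 'rV[R]_d), T <= t -> u t x = 0.
Proof.
set I := `[T, +oo[%classic.
have [u_C2 u_eqn] := u_sol.
have [C0 [C0_gt0 FC0]] := F_bound.
pose uc j := component u j.
pose v j := dt I (uc j).
pose a j := dt I (v j).
pose b j k := dx k (uc j).
pose vx j k := dx k (v j).
pose bx j k := dx k (b j k).
pose G j t x := F (u t x) (Dt I u t x) (Dx u t x) 0 j.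
pose e := energy m uc v b.
have I_gt t : T < t -> I t by move=> Tt; rewrite /I/= in_itv/= andbT ltW.
have v1 j : Cn 1 I (v j) := Cn_dt (u_C2 j).
have b1 j k : Cn 1 I (b j k) := Cn_dx k (u_C2 j).
have slice (g : R -> 'rV[R]_d -> R) t :
    (forall x, {for (t, x), continuous (fun p => g p.1 p.2)}) -> continuous (g t).
  move=> cg x; apply: (@continuous_comp _ _ _ (fun x => (t, x)) (fun p => g p.1 p.2) x).
    exact: (@cvg_pair _ _ _ (nbhs x) (nbhs t) (nbhs x) _ _ _ (cst t) id (cvg_cst t) cvg_id).
  exact: cg.
have cont_u t : T < t -> continuous (fun x => enorm (u t x)).
  move=> Tt; apply: continuous_enorm => j; apply: (slice (uc j)) => x.
  exact: Cn_continuous_for (u_C2 j) _ x Tt.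
have cont_v t : T < t -> continuous (fun x => enorm (Dt I u t x)).
  move=> Tt; apply: continuous_enorm => j.
  rewrite (_ : (fun _ => _) = v j t); last by apply/funext => x; rewrite mxE.
  by apply: (slice (v j)) => x; exact: Cn_continuous_for (v1 j) _ x Tt.
have cont_b t : T < t -> continuous (fun x => frobenius (Dx u t x)).
  move=> Tt; apply: continuous_frobenius => j k.
  rewrite (_ : (fun _ => _) = b j k t); last by apply/funext => x; rewrite mxE.
  by apply: (slice (b j k)) => x; exact: Cn_continuous_for (b1 j k) _ x Tt.
pose Q t x := enorm (u t x) ^+ 2 + enorm (Dt I u t x) ^+ 2 + frobenius (Dx u t x) ^+ 2.
(* These constants compare [Q], the square of the norm of [U], with the energy:
   [1 <= c1 * m j ^+ 2], where positive masses enter, and [m j ^+ 2 <= c2]. *)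
pose c1 := 1 + \sum_j (m j ^+ 2)^-1.
pose c2 := 1 + \sum_j m j ^+ 2.
have c1_ge1 : 1 <= c1.
  by rewrite lerDl; apply: sumr_ge0 => j _; rewrite invr_ge0 sqr_ge0.
have c2_ge1 : 1 <= c2.
  by rewrite lerDl; apply: sumr_ge0 => j _; rewrite sqr_ge0.
have QE t x : Q t x = \sum_j (v j t x ^+ 2 + \sum_k b j k t x ^+ 2 + uc j t x ^+ 2).
  rewrite /Q !enorm_sqr frobenius_sqr !big_split/=.
  have -> : \sum_j (Dt I u t x) 0 j ^+ 2 = \sum_j v j t x ^+ 2.
    by apply: eq_bigr => j _; rewrite mxE.
  have -> : \sum_j \sum_k (Dx u t x) j k ^+ 2 = \sum_j \sum_k b j k t x ^+ 2.
    by apply: eq_bigr => j _; apply: eq_bigr => k _; rewrite mxE.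
  by rewrite -[LHS]addrA; exact: addrC.
have sb_ge0 j t x : 0 <= \sum_k b j k t x ^+ 2.
  by apply: sumr_ge0 => k _; exact: sqr_ge0.
have Q_le_e t x : Q t x <= 2 * c1 * e t x.
  rewrite QE /e /energy.
  have -> (s : R) : 2 * c1 * (2^-1 * s) = c1 * s by field.
  rewrite mulr_sumr; apply: ler_sum => j _.
  have cm : 1 <= c1 * m j ^+ 2.
    rewrite -ler_pdivrMr ?exprn_gt0// div1r /c1 (bigD1 j)//= addrCA lerDl addr_ge0//.
    by apply: sumr_ge0 => i _; rewrite invr_ge0 sqr_ge0.
  have h1 : uc j t x ^+ 2 <= c1 * (m j ^+ 2 * uc j t x ^+ 2).
    by rewrite mulrA ler_peMl ?sqr_ge0.
  have h2 : v j t x ^+ 2 <= c1 * v j t x ^+ 2 by rewrite ler_peMl ?sqr_ge0.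
  have h3 : \sum_k b j k t x ^+ 2 <= c1 * \sum_k b j k t x ^+ 2 by rewrite ler_peMl.
  by rewrite !mulrDr; lra.
have e_le_Q t x : e t x <= c2 * Q t x.
  rewrite QE /e /energy !mulr_sumr; apply: ler_sum => j _.
  have cm : m j ^+ 2 <= c2.
    rewrite /c2 (bigD1 j)//= addrCA lerDl addr_ge0//.
    by apply: sumr_ge0 => i _; rewrite sqr_ge0.
  have h1 : m j ^+ 2 * uc j t x ^+ 2 <= c2 * uc j t x ^+ 2.
    by apply: ler_wpM2r cm; rewrite sqr_ge0.
  have h2 : v j t x ^+ 2 <= c2 * v j t x ^+ 2 by rewrite ler_peMl ?sqr_ge0.
  have h3 := sb_ge0 j t x.
  have h4 : \sum_k b j k t x ^+ 2 <= c2 * \sum_k b j k t x ^+ 2 by rewrite ler_peMl.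
  have := sqr_ge0 (v j t x); have := mulr_ge0 (sqr_ge0 (m j)) (sqr_ge0 (uc j t x)).
  by rewrite !mulrDr; lra.
have s_gt0 : 0 < 2 / d%:R :> R by rewrite divr_gt0// ltr0n.
(* Chosen so that [N * C0 * kappa * (2 * c1)] is [1/2], the coefficient in the derivative of
   [log_weight]. *)
pose kappa := (4 * (N%:R * C0) * c1)^-1.
have kappa_gt0 : 0 < kappa.
  by rewrite invr_gt0 !mulr_gt0// ?ltr0n//; lra.
(* With [eps <= 1] the three decay bounds add up to [2 * C ^+ 2 + 1 <= C' ^+ 2] times the squared
   rate. *)
pose C' := 2 * C + 1.
have C'_gt0 : 0 < C' by rewrite /C'; lra.
have [eps /andP[eps0 eps1] Heps] := small_nonlinearity s_gt0 kappa_gt0 C'_gt0.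
have [T2 [T12 uT2]] := ut_decay eps eps0.
have decay t x : T < t -> T2 <= t -> [/\ enorm (u t x) <= C * rate d t,
    frobenius (Dx u t x) <= C * rate d t & enorm (Dt I u t x) <= eps * rate d t].
  move=> Tt T2t; have T1t := le_trans T12 T2t.
  have [h1 h2] : (forall x, enorm (u t x) <= C * rate d t) /\
      (forall x, frobenius (Dx u t x) <= C * rate d t).
    apply: Linfty_add_le; [exact: cont_u|exact: cont_b|].
    by rewrite /rate mulrA; exact: u_decay.
  split => //; move: x; apply: Linfty_norm_ge; first exact: cont_v.
  by rewrite /rate mulrA; exact: uT2.
have Q_decay t x : T < t -> T2 <= t -> Q t x <= (C' * rate d t) ^+ 2.
  move=> Tt T2t; have [h1 h2 h3] := decay t x Tt T2t.
  have A0 : 0 < rate d t by apply: rate_gt0; lra.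
  have sq (p q : R) : 0 <= p -> p <= q * rate d t -> p ^+ 2 <= q ^+ 2 * rate d t ^+ 2.
    by move=> p0 pq; rewrite -exprMn lerXn2r// nnegrE// (le_trans p0).
  apply: le_trans (lerD (lerD (sq _ _ _ h1) (sq _ _ _ h3)) (sq _ _ _ h2)) _;
    rewrite ?enorm_ge0 ?sqrtr_ge0//.
  rewrite [leRHS](exprMn _ C') -!mulrDl; apply: ler_wpM2r; first exact: sqr_ge0.
  have : eps ^+ 2 <= 1 by rewrite exprn_ile1// ltW.
  by have := sqr_ge0 C; rewrite /C' sqrrD exprMn expr1n mulr1; lra.
have power_bound t x : T < t -> T2 <= t ->
    `|\sum_j v j t x * G j t x| <= 2^-1 * (t * ln t)^-1 * e t x.
  move=> Tt T2t; have [_ _ h3] := decay t x Tt T2t.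
  have t1 : 1 < t by lra.
  have tl0 : 0 < (t * ln t)^-1 by rewrite invr_gt0 mulr_gt0 ?ln_gt0//; lra.
  pose al := enorm (Dt I u t x).
  have al0 : 0 <= al := enorm_ge0 _.
  pose B := Num.sqrt (Q t x).
  have Q0 : 0 <= Q t x by rewrite /Q !addr_ge0 ?sqr_ge0.
  have BQ : B ^+ 2 = Q t x by rewrite sqr_sqrtr.
  have A0 := rate_gt0 d t1.
  have alB : al <= B.
    rewrite -(@ler_pXn2r _ 2) ?nnegrE ?sqrtr_ge0// BQ /Q -/al.
    by have := sqr_ge0 (enorm (u t x)); have := sqr_ge0 (frobenius (Dx u t x)); lra.
  have BA : B <= C' * rate d t.
    have CA0 : 0 <= C' * rate d t by apply: mulr_ge0; exact: ltW.
    rewrite -(@ler_pXn2r _ 2) ?nnegrE ?sqrtr_ge0//.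
    by rewrite BQ; exact: Q_decay.
  have := Heps _ _ _ A0 al0 alB BA h3; rewrite BQ rate_powR// => HQ.
  have FQ : enorm (F (u t x) (Dt I u t x) (Dx u t x))
      <= C0 * Q t x `^ (2^-1 * (1 + 2 / d%:R)) by exact: FC0.
  (* Each of the [N] products is bounded by the full norms of u_t and [F]. *)
  apply: (@le_trans _ _ (N%:R * (al * enorm (F (u t x) (Dt I u t x) (Dx u t x))))).
    apply: le_trans (ler_norm_sum _ _ _) _.
    rewrite mulr_natl -[X in _ *+ X](card_ord N) -sumr_const; apply: ler_sum => j _.
    rewrite normrM; apply: ler_pM => //; last exact: normr_le_enorm.
    by have := normr_le_enorm (Dt I u t x) j; rewrite mxE.
  apply: (@le_trans _ _ (N%:R * C0 * (kappa * (t * ln t)^-1 * (2 * c1 * e t x)))).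
    rewrite -mulrA ler_wpM2l//.
    apply: (@le_trans _ _ (C0 * (Q t x `^ (2^-1 * (1 + 2 / d%:R)) * al))).
      by rewrite mulrA [leRHS]mulrC ler_wpM2l.
    apply: ler_wpM2l; first exact: ltW.
    by apply: le_trans HQ _; rewrite ler_wpM2l// mulr_ge0// ltW.
  rewrite /kappa le_eqVlt; apply/orP; left; apply/eqP; field.
  by rewrite !gt_eqF ?mulr_gt0 ?ltr0n ?ln_gt0//; lra.
(* Positive energy at one point would give a positive lower bound, uniform in later times, for a
   quantity that tends to zero. *)
have vanish t0 x0 : T < t0 -> T2 <= t0 -> e t0 x0 = 0.
  move=> Tt0 T2t0; apply/eqP; rewrite eq_le energy_ge0 andbT leNgt; apply/negP => e0.
  have t01 : 1 < t0 by lra.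
  (* This makes [r + t0] larger than the norm of [x0], so the cone contains [x0] at time [t0]. *)
  pose r := 1 + \sum_i x0 0 i ^+ 2.
  have sx0 : 0 <= \sum_i x0 0 i ^+ 2 by apply: sumr_ge0 => i _; exact: sqr_ge0.
  have [K K0 HK] : exists2 K, 0 < K & forall t1 M, t0 < t1 -> (forall x, e t1 x <= M) ->
      K * log_weight t0 <= log_weight t1 * ((2 * (r + t1)) ^+ d * M).
    apply: (@local_energy _ _ _ T m uc v a b vx bx G _ _ _ _ _ _ _ _ _ _ _ r t0 x0
      (fun t => 2^-1 * (t * ln t)^-1)).
    - by move=> j t x Tt; exact: Cn_is_derive_t (u_C2 j) _ x Tt.
    - by move=> j t x Tt; exact: Cn_is_derive_t (v1 j) _ x Tt.
    - move=> j k t x Tt; rewrite /vx /v (C2_mixed k x (u_C2 j) Tt).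
      exact: Cn_is_derive_t (b1 j k) _ x Tt.
    - by move=> j k t x Tt; exact: Cn_is_derive_x (v1 j) _ x k Tt.
    - by move=> j k t x Tt; exact: Cn_is_derive_x (b1 j k) _ x k Tt.
    - by move=> j t x Tt; exact: Cn_continuous_for (u_C2 j) _ x Tt.
    - by move=> j t x Tt; exact: Cn_continuous_for (v1 j) _ x Tt.
    - by move=> j k t x Tt; exact: Cn_continuous_for (b1 j k) _ x Tt.
    - by move=> j k t x Tt; exact: Cn_continuous_for (Cn_dx k (v1 j)) _ x Tt.
    - by move=> j k t x Tt; exact: Cn_continuous_for (Cn_dx k (b1 j k)) _ x Tt.
    - move=> j t x Tt; have := u_eqn t x j (I_gt t Tt).
      change (a j t x - \sum_k bx j k t x + m j ^+ 2 * uc j t x = G j t x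
        -> a j t x = \sum_k bx j k t x - m j ^+ 2 * uc j t x + G j t x).
      by lra.
    - exact: Tt0.
    - by rewrite /r; lra.
    - rewrite /cone subr_gt0 /r.
      by have := sqr_ge0 (\sum_i x0 0 i ^+ 2); nra.
    - exact: e0.
    - by move=> t t0t; apply: is_derive_log_weight; lra.
    - by move=> t t0t; exact: powR_ge0.
    - by move=> s t t0s st; apply: le_log_weight => //; lra.
    - by move=> t x t0t; apply: power_bound; lra.
  have : K * log_weight t0 <= 0.
    apply: (@rate_limit _ _ d_gt0 r t0 _ (c2 * C' ^+ 2)).
    - by rewrite /r; lra.
    - by rewrite mulr_ge0 ?sqr_ge0//; lra.
    - move=> t t0t t1; apply: HK => // x.
      apply: le_trans (e_le_Q t x) _; rewrite -mulrA -exprMn.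
      by apply: ler_wpM2l; [lra|apply: Q_decay; lra].
  by rewrite leNgt mulr_gt0// powR_gt0 ?ln_gt0.
pose t0 := Num.max T T2 + 1.
have [Tt0 T2t0] : T < t0 /\ T2 <= t0.
  have : T <= Num.max T T2 by rewrite le_max lexx.
  have : T2 <= Num.max T T2 by rewrite le_max lexx orbT.
  by rewrite /t0; lra.
have Q0 x : Q t0 x = 0.
  have := Q_le_e t0 x; rewrite vanish// mulr0 => Qle0.
  by apply/eqP; rewrite eq_le Qle0 /Q !addr_ge0 ?sqr_ge0.
have enorm_eq0 n (w : 'rV[R]_n) : enorm w ^+ 2 <= 0 -> w = 0.
  rewrite enorm_sqr => w0; apply/rowP => j; rewrite mxE; apply/eqP.
  rewrite -sqrf_eq0 eq_le sqr_ge0 andbT; apply: le_trans w0.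
  by rewrite (bigD1 j)//= lerDl sumr_ge0// => i _; exact: sqr_ge0.
have F0 : F 0 0 0 = 0.
  apply: enorm_eq0.
  have z (n : nat) : enorm (0 : 'rV[R]_n) ^+ 2 = 0.
    by rewrite enorm_sqr big1// => j _; rewrite mxE expr0n.
  have := FC0 0 0 0; rewrite !z frobenius_sqr big1 ?addr0; last first.
    by move=> i _; apply: big1 => j _; rewrite mxE expr0n.
  (* The exponent is nonzero, so the power of [0] is [0] rather than the value [1] that goes with
     exponent [0]. *)
  rewrite powR0 ?mulr0 => [F0|]; last by rewrite mulf_neq0 ?gt_eqF// addr_gt0.
  by rewrite expr2 mulr_le0_ge0// enorm_ge0.
move=> t x Tt.
have I_itv : time_interval I.
  split; first exact: interval_is_interval.
  exists T, (T + 1); split; last by rewrite ltrDl ltr01.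
    by rewrite /I/= in_itv/= lexx.
  by rewrite /I/= in_itv/= lerDl ler01.
have z_sol : classical_solution m F I (fun _ _ => 0) by exact: zero_classical_solution.
(* The Cauchy data of [u] vanish at the interior time [t0]; uniqueness on all of [I] then also
   covers the times before [t0]. *)
have agree : exists s, [/\ I s, forall y, u s y = 0 &
    forall y, Dt I u s y = Dt I (fun _ _ => 0) s y].
  exists t0; split=> [|y|y]; first exact: I_gt.
    apply: enorm_eq0; rewrite -(Q0 y) /Q.
    by have := sqr_ge0 (enorm (Dt I u t0 y)); have := sqr_ge0 (frobenius (Dx u t0 y)); lra.
  transitivity (0 : 'rV[R]_N).
    apply: enorm_eq0; rewrite -(Q0 y) /Q.
    by have := sqr_ge0 (enorm (u t0 y)); have := sqr_ge0 (frobenius (Dx u t0 y)); lra.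
  apply/rowP => j; rewrite !mxE; apply/esym/dt_zero; last exact: I_gt.
  by move=> s z _; rewrite /component mxE.
have It : I t by rewrite /I/= in_itv/= Tt.
exact: (F_unique I u _ I_itv u_sol z_sol agree t x It).
Qed.
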